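(* Assume $\theta\ge 1$. Let $\varsigma>0$ be such that the solution $V$ of the discrete HJB system (D) satisfies $\Delta^-V_{i,j}\ge\varsigma$ for all $1\le i\le I$, $j\in\{1,2\}$, and let $\varepsilon>0$ satisfy $1/\varepsilon>r\bar x+y_2$ and $1/\varepsilon>\rho^{\psi}\varsigma^{-\psi}\big((1-\gamma)\check V_{I,2}\big)^{\frac{1-\gamma\psi}{1-\gamma}}$. Let $(V^{(n)})_{n\ge 0}$ be the sequence of grid functions generated by the Howard-Newton algorithm described in the context. Then $V^{(n)}$ converges, as $n\to\infty$, to the unique solution of the discrete HJB system (D).
   Context: Parameters: $\gamma>1$, $0<\psi<1$, $\rho>r>0$, $y_2>y_1>0$, $\lambda_1,\lambda_2>0$, and $\underline x$ with $\rho\underline x+y_1>0$. Set $\theta=\frac{1-\psi^{-1}}{1-\gamma}>0$, $b=\rho\left[\frac{r+\psi(\rho-r)}{\rho}\right]^{\frac1{1-\psi}}$, and $\bar\jmath=3-j$ for $j\in\{1,2\}$. For $c>0$, $v<0$: $\mathcal F(c,v)=\frac{\rho}{1-\psi^{-1}}\,c^{1-\psi^{-1}}\,((1-\gamma)v)^{1-\theta}$. For $v<0$ and $rx+y>0$: $H(x,y,v,p)=(rx+y)p+\frac{\rho^\psi}{\psi-1}p^{1-\psi}((1-\gamma)v)^{\frac{1-\gamma\psi}{1-\gamma}}$ if $p\ge0$, and $H=+\infty$ if $p<0$. Grid: $\underline x\le 0<\bar x$, $I\ge 1$ an integer, $\Delta x=(\bar x-\underline x)/I$, $x_i=\underline x+i\Delta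 x$ for $0\le i\le I$. A grid function is $V=(V_{i,j})_{0\le i\le I,\,j\in\{1,2\}}$; grid functions used as third argument of the Hamiltonian (or second argument of $\mathcal F$) take strictly negative values. $\Delta^+V_{i,j}=(V_{i+1,j}-V_{i,j})/\Delta x$ for $i<I$, $\Delta^-V_{i,j}=(V_{i,j}-V_{i-1,j})/\Delta x$ for $i>0$ (the values of $\Delta^+V_{I,j}$, $\Delta^-V_{0,j}$ are arbitrary and play no role). Put $\bar c_j(x)=rx+y_j$. Discrete Hamiltonian: for $v<0$ let $p_{\min}(x,y,v)=\rho(rx+y)^{-1/\psi}((1-\gamma)v)^{1-\theta}$ be the minimizer of $H(x,y,v,\cdot)$ and $H_{\min}(x,y,v)=\min_pH(x,y,v,p)$. $H^\uparrow(x,y,v,p)=H(x,y,v,p)$ if $p\ge p_{\min}(x,y,v)$ and $H_{\min}(x,y,v)$ if $p<p_{\min}(x,y,v)$. $H^\downarrow(x,y,v,p)=H(x,y,v,p)$ if $0\le p\le p_{\min}(x,y,v)$, $H_{\min}(x,y,v)$ if $p>p_{\min}(x,y,v)$, $+\infty$ if $p<0$. $\boldsymbol H(x_i,y_j,v,p^F,p^B)$ equals $H^\uparrow(x_i,y_j,v,p^F)$ if $i=0$; $H^\uparrow(x_i,y_j,v,p^F)+H^\downarrow(x_i,y_j,v,p^B)-H_{\min}(x_i,y_j,v)$ if $0<i<I$; $H^\downarrow(x_i,y_j,v,p^B)$ if $i=I$. System (D): for all $0\le i\le I$, $j\in\{1,2\}$, $\frac\rho\theta V_{i,j}=\boldsymbol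 H(x_i,y_j,V_{i,j},\Delta^+V_{i,j},\Delta^-V_{i,j})+\lambda_j(V_{i,\bar\jmath}-V_{i,j})$. $\check V_{i,1}=\check V_{i,2}=\frac{(b(x_i+y_2/r))^{1-\gamma}}{1-\gamma}$. Howard-Newton algorithm (run without a stopping test; each policy evaluation equation is solved exactly). Start with $c^{F,(0)}_{i,j}=c^{B,(0)}_{i,j}=rx_i+y_j$. For $n=0,1,2,\dots$: set $s^{F,(n)}_{i,j}=rx_i+y_j-c^{F,(n)}_{i,j}$, $s^{B,(n)}_{i,j}=rx_i+y_j-c^{B,(n)}_{i,j}$; let $V^{(n)}$ (strictly negative) solve, for all $i,j$, $$\frac\rho\theta V^{(n)}_{i,j}=s^{F,(n)}_{i,j}\Delta^+V^{(n)}_{i,j}+s^{B,(n)}_{i,j}\Delta^-V^{(n)}_{i,j}+\mathcal F(c^{F,(n)}_{i,j},V^{(n)}_{i,j})+\mathcal F(c^{B,(n)}_{i,j},V^{(n)}_{i,j})-\mathcal F(\bar c_j(x_i),V^{(n)}_{i,j})+\lambda_j(V^{(n)}_{i,\bar\jmath}-V^{(n)}_{i,j});$$ then put, with $(z)_+=\max(z,0)$ and $0^{-\psi}=+\infty$, $c^{F,(n+1)}_{i,j}=\min\{\rho^\psi(\Delta^+V^{(n)}_{i,j})_+^{-\psi}((1-\gamma)V^{(n)}_{i,j})^{\frac{1-\gamma\psi}{1-\gamma}},\bar c_j(x_i)\}$ for $i<I$, $c^{F,(n+1)}_{I,j}=r\bar x+y_j$, and $c^{B,(n+1)}_{i,j}=\max\{\min\{1/\varepsilon,\rho^\psi(\Delta^-V^{(n)}_{i,j})_+^{-\psi}((1-\gamma)V^{(n)}_{i,j})^{\frac{1-\gamma\psi}{1-\gamma}}\},\bar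 c_j(x_i)\}$ for $i>0$, $c^{B,(n+1)}_{0,j}=r\underline x+y_j$. *)

(* Defs.v *)
From mathcomp Require Import all_boot all_order all_algebra.
From mathcomp Require Import all_classical all_reals all_analysis.
Set Implicit Arguments.
Unset Strict Implicit.
Unset Printing Implicit Defensive.
Import Order.TTheory GRing.Theory Num.Theory.
Import numFieldNormedType.Exports.
Local Open Scope classical_set_scope.
Local Open Scope ring_scope.

(* The income states 1 and 2 are the elements ord0 and ord_max of 'I_2. *)
Record model (R : realType) := Model {
  gamma : R;
  psi : R;
  rho : R;
  rate : R;
  income : 'I_2 -> R;
  lam : 'I_2 -> R;
  xlow : R;
  xhigh : R;
  nI : nat;
  gamma_gt1 : 1 < gamma;
  psi_gt0 : 0 < psi;
  psi_lt1 : psi < 1;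
  rate_gt0 : 0 < rate;
  rate_lt_rho : rate < rho;
  income1_gt0 : 0 < income ord0;
  income1_lt_income2 : income ord0 < income ord_max;
  lam_gt0 : forall j, 0 < lam j;
  rho_xlow_income1 : 0 < rho * xlow + income ord0;
  xlow_le0 : xlow <= 0;
  xhigh_gt0 : 0 < xhigh;
  nI_gt0 : (0 < nI)%N
}.

Definition theta (R : realType) (m : model R) : R :=
  (1 - (psi m)^-1) / (1 - gamma m).

Definition bconst (R : realType) (m : model R) : R :=
  rho m *
  ((rate m + psi m * (rho m - rate m)) / rho m) `^ (1 - psi m)^-1.

Definition vexp (R : realType) (m : model R) : R :=
  (1 - gamma m * psi m) / (1 - gamma m).

Definition Fagg (R : realType) (m : model R) (c v : R) : R :=
  rho m / (1 - (psi m)^-1) * c `^ (1 - (psi m)^-1) *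
  ((1 - gamma m) * v) `^ (1 - theta m).

Definition Ham (R : realType) (m : model R) (x y v p : R) : \bar R :=
  if 0 <= p then
    ((rate m * x + y) * p +
     rho m `^ psi m / (psi m - 1) * p `^ (1 - psi m) *
     ((1 - gamma m) * v) `^ vexp m)%:E
  else +oo%E.

Definition pmin (R : realType) (m : model R) (x y v : R) : R :=
  rho m * (rate m * x + y) `^ (- (psi m)^-1) *
  ((1 - gamma m) * v) `^ (1 - theta m).

Definition Hmin (R : realType) (m : model R) (x y v : R) : \bar R :=
  ereal_inf [set Ham m x y v p | p in [set: R]].

Definition Hup (R : realType) (m : model R) (x y v p : R) : \bar R :=
  if pmin m x y v <= p then Ham m x y v p else Hmin m x y v.

Definition Hdown (R : realType) (m : model R) (x y v p : R) : \bar R :=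
  if p < 0 then +oo%E
  else if p <= pmin m x y v then Ham m x y v p else Hmin m x y v.

Definition grid (R : realType) (m : model R) : Type :=
  'I_(nI m).+1 -> 'I_2 -> R.

Definition negative_grid (R : realType) (m : model R) (V : grid m) : Prop :=
  forall i j, V i j < 0.

Definition dx (R : realType) (m : model R) : R :=
  (xhigh m - xlow m) / (nI m)%:R.

Definition xgrid (R : realType) (m : model R) (i : 'I_(nI m).+1) : R :=
  xlow m + i%:R * dx m.

Definition cbar (R : realType) (m : model R) (i : 'I_(nI m).+1) (j : 'I_2) : R :=
  rate m * xgrid i + income m j.

(* The values Dplus V i j for i = nI m and Dminus V i j for i = 0 are junk:
   every use below discards them or multiplies them by a zero drift. *)
Definition Dplus (R : realType) (m : model R) (V : grid m) : grid m :=
  fun i j => (V (inord i.+1) j - V i j) / dx m.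

Definition Dminus (R : realType) (m : model R) (V : grid m) : grid m :=
  fun i j => (V i j - V (inord i.-1) j) / dx m.

Definition discreteH (R : realType) (m : model R) (i : 'I_(nI m).+1)
    (j : 'I_2) (v pF pB : R) : \bar R :=
  let x := xgrid i in
  let y := income m j in
  if i == ord0 then Hup m x y v pF
  else if i == ord_max then Hdown m x y v pB
  else (Hup m x y v pF + Hdown m x y v pB - Hmin m x y v)%E.

(* rev_ord exchanges the two elements of 'I_2. *)
Definition jump (R : realType) (m : model R) (V : grid m)
    (i : 'I_(nI m).+1) (j : 'I_2) : R :=
  lam m j * (V i (rev_ord j) - V i j).

Definition discrete_HJB (R : realType) (m : model R) (V : grid m) : Prop :=
  negative_grid V /\
  forall i j,
    (rho m / theta m * V i j)%:E =
    (discreteH i j (V i j) (Dplus V i j) (Dminus V i j) + (jump V i j)%:E)%E.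

Definition Vcheck (R : realType) (m : model R) : grid m :=
  fun i _ =>
    (bconst m * (xgrid i + income m ord_max / rate m)) `^ (1 - gamma m) /
    (1 - gamma m).
Arguments Vcheck {R} m _ _.

Definition policy_evaluation (R : realType) (m : model R)
    (cF cB V : grid m) : Prop :=
  negative_grid V /\
  forall i j,
    rho m / theta m * V i j =
    (cbar i j - cF i j) * Dplus V i j + (cbar i j - cB i j) * Dminus V i j +
    Fagg m (cF i j) (V i j) + Fagg m (cB i j) (V i j) -
    Fagg m (cbar i j) (V i j) + jump V i j.

(* (z)_+ ^ (- psi), with 0 ^ (- psi) = +oo; powR alone would give 0 at 0. *)
Definition pos_powN (R : realType) (m : model R) (z : R) : \bar R :=
  if Num.max z 0 == 0 then +oo%E else ((Num.max z 0) `^ (- psi m))%:E.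

Definition consumption (R : realType) (m : model R) (p v : R) : \bar R :=
  ((rho m `^ psi m)%:E * pos_powN m p * (((1 - gamma m) * v) `^ vexp m)%:E)%E.

Definition policy_improvement (R : realType) (m : model R) (eps : R)
    (V cF cB : grid m) : Prop :=
  [/\ forall (i : 'I_(nI m).+1) (j : 'I_2), i != ord_max ->
        (cF i j)%:E =
        Order.min (consumption m (Dplus V i j) (V i j)) (cbar i j)%:E,
      forall j, cF ord_max j = rate m * xhigh m + income m j,
      forall (i : 'I_(nI m).+1) (j : 'I_2), i != ord0 ->
        (cB i j)%:E =
        Order.max
          (Order.min (eps^-1)%:E (consumption m (Dminus V i j) (V i j)))
          (cbar i j)%:E &
      forall j, cB ord0 j = rate m * xlow m + income m j].

Definition howard_newton (R : realType) (m : model R) (eps : R)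
    (V cF cB : nat -> grid m) : Prop :=
  [/\ forall i j, cF 0%N i j = cbar i j,
      forall i j, cB 0%N i j = cbar i j,
      forall n, policy_evaluation (cF n) (cB n) (V n) &
      forall n, policy_improvement eps (V n) (cF n.+1) (cB n.+1)].

(* Main.v *)
Require Import Defs.
From mathcomp Require Import all_boot all_order all_algebra.
From mathcomp Require Import all_classical all_reals all_analysis.
From mathcomp Require Import ring lra.
Set Implicit Arguments.
Unset Strict Implicit.
Unset Printing Implicit Defensive.
Import Order.TTheory GRing.Theory Num.Theory.
Import numFieldNormedType.Exports.
Local Open Scope classical_set_scope.
Local Open Scope ring_scope.

(** With [F(c, v) = - wt v * kap c], the discrete Hamiltonian is the supremum of
    [gain] over the policies [cF <= cbar <= cB], and every fixed-policy equation
    satisfies a comparison principle because upwinding is monotone and [wt] is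
    nondecreasing when [theta >= 1].  Hence the iterates increase, and they stay
    below every solution of (D).  A solution [W] of (D) lies below [Vcheck], so the
    slope bound [varsigma] gives it an optimal policy with [cB <= 1/eps]; testing the
    limit of the iterates with that policy shows that the limit is above [W].
    Every solution is thus the limit of the iterates, which gives uniqueness.
    Existence, on which the slope hypothesis says nothing, is Perron's method: the
    infimum of all supersolutions is a solution. *)

(** * Inequalities for power functions *)

(** The graph of a convex function lies above its tangents. Scaling by [x] reduces this to
    [t = y / x], where [t ^ (- s) = exp (- s ln t) >= 1 - s ln t >= 1 - s (t - 1)]. *)
Lemma powR_tangent (R : realType) (s x y : R) : 0 < s -> 0 < x -> 0 < y ->
  x `^ (- s) - s * x `^ (- s - 1) * (y - x) <= y `^ (- s).
Proof.
move=> s0 x0 y0.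
have t0 : 0 < y / x by rewrite divr_gt0.
have -> : y `^ (- s) = x `^ (- s) * (y / x) `^ (- s).
  by rewrite -powRM ?ltW// mulrCA divff ?gt_eqF// mulr1.
have -> : x `^ (- s) - s * x `^ (- s - 1) * (y - x) =
          x `^ (- s) * (1 - s * (y / x - 1)).
  rewrite powRB; last by rewrite (gt_eqF x0) implybT.
  rewrite powRr1 ?ltW//; field; exact: lt0r_neq0.
rewrite ler_wpM2l ?powR_ge0// [leRHS]/powR gt_eqF//.
apply: le_trans (expR_ge1Dx _).
rewrite lerD2l mulNr lerN2 ler_pM2l//.
have := @le_ln1Dx R (y / x - 1); rewrite addrCA subrr addr0; apply.
by rewrite ltrBrDr addrC subrr.
Qed.

Lemma powR_lt0_le (R : realType) (s x y : R) : s <= 0 -> 0 < x -> x <= y ->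
  y `^ s <= x `^ s.
Proof.
move=> s0 x0 xy; rewrite -[s]opprK !(powRN _ (- s)).
rewrite lef_pV2 ?posrE ?powR_gt0 ?(lt_le_trans x0)//.
by rewrite ge0_ler_powR ?oppr_ge0// nnegrE ltW// (lt_le_trans x0).
Qed.

Lemma powRK (R : realType) (s x : R) : s != 0 -> 0 <= x -> (x `^ s) `^ s^-1 = x.
Proof. by move=> s0 x0; rewrite -powRrM divff// powRr1. Qed.

(** * Signs of the parameters and geometry of the grid *)

Lemma psi_inv_gt1 (R : realType) (m : model R) : 0 < (psi m)^-1 - 1.
Proof. by rewrite subr_gt0 invf_gt1 ?psi_gt0 ?psi_lt1. Qed.

Lemma rho_gt0 (R : realType) (m : model R) : 0 < rho m.
Proof. exact: lt_trans (rate_gt0 m) (rate_lt_rho m). Qed.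

Lemma theta_gt0 (R : realType) (m : model R) : 0 < theta m.
Proof.
rewrite /theta nmulr_rgt0 ?invr_lt0 ?subr_lt0 ?gamma_gt1//.
by rewrite invf_gt1 ?psi_gt0 ?psi_lt1.
Qed.

Lemma dx_gt0 (R : realType) (m : model R) : 0 < dx m.
Proof.
rewrite divr_gt0 ?ltr0n ?nI_gt0// subr_gt0.
exact: le_lt_trans (xlow_le0 m) (xhigh_gt0 m).
Qed.

Lemma xgrid_ord_max (R : realType) (m : model R) : xgrid (ord_max : 'I_(nI m).+1) = xhigh m.
Proof.
rewrite /xgrid /dx/= mulrCA divff ?mulr1 ?pnatr_eq0 -?lt0n ?nI_gt0//.
by rewrite addrC subrK.
Qed.

Lemma xgrid_homo (R : realType) (m : model R) (i k : 'I_(nI m).+1) :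
  (i <= k)%N -> xgrid i <= xgrid k.
Proof. by move=> ik; rewrite lerD2l ler_wpM2r ?ler_nat// ltW ?dx_gt0. Qed.

Lemma xlow_le_xgrid (R : realType) (m : model R) (i : 'I_(nI m).+1) : xlow m <= xgrid i.
Proof. by rewrite lerDl mulr_ge0// ltW ?dx_gt0. Qed.

Lemma xgrid_le_xhigh (R : realType) (m : model R) (i : 'I_(nI m).+1) : xgrid i <= xhigh m.
Proof. by rewrite -xgrid_ord_max xgrid_homo// -ltnS. Qed.

Lemma ord2P (j : 'I_2) : j = ord0 \/ j = ord_max.
Proof. by case: j => [[|[|//]] ?]; [left|right]; apply/val_inj. Qed.

Lemma le_income_max (R : realType) (m : model R) j : income m j <= income m ord_max.
Proof. by case: (ord2P j) => ->//; rewrite ltW ?income1_lt_income2. Qed.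

Lemma ge_income_min (R : realType) (m : model R) j : income m ord0 <= income m j.
Proof. by case: (ord2P j) => ->//; rewrite ltW ?income1_lt_income2. Qed.

(** Since [xlow <= 0] and [rate < rho], [rate * xlow] dominates [rho * xlow], so the model's
    borrowing limit applies. *)
Lemma cbar_gt0 (R : realType) (m : model R) (i : 'I_(nI m).+1) j : 0 < cbar i j.
Proof.
apply: (lt_le_trans (rho_xlow_income1 m)); apply: lerD; last exact: ge_income_min.
apply: (@le_trans _ _ (rate m * xlow m)).
  by rewrite ler_wnM2r ?xlow_le0// ltW ?rate_lt_rho.
by rewrite ler_wpM2l ?xlow_le_xgrid// ltW ?rate_gt0.
Qed.

Lemma cbar_le_max (R : realType) (m : model R) (i : 'I_(nI m).+1) j :
  cbar i j <= rate m * xhigh m + income m ord_max.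
Proof.
apply: lerD; last exact: le_income_max.
by rewrite ler_wpM2l ?xgrid_le_xhigh// ltW ?rate_gt0.
Qed.

(** * The aggregator as a weight times a convex cost *)

(** Isoelastic utility with its sign reversed: as [psi < 1], it is positive, decreasing and convex
    on positive consumption. *)
Definition kap (R : realType) (m : model R) (c : R) : R :=
  c `^ (1 - (psi m)^-1) / ((psi m)^-1 - 1).

Definition wt (R : realType) (m : model R) (v : R) : R :=
  rho m * ((1 - gamma m) * v) `^ (1 - theta m).

Lemma Fagg_wt (R : realType) (m : model R) (c v : R) : Fagg m c v = - (wt m v * kap m c).
Proof.
rewrite /Fagg /wt /kap -[1 - (psi m)^-1 in X in X^-1](opprB) invrN; ring.
Qed.

Lemma wealth_gt0 (R : realType) (m : model R) (v : R) : v < 0 -> 0 < (1 - gamma m) * v.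
Proof. by move=> v0; rewrite nmulr_rgt0// subr_lt0 gamma_gt1. Qed.

Lemma wt_gt0 (R : realType) (m : model R) (v : R) : v < 0 -> 0 < wt m v.
Proof. by move=> v0; rewrite mulr_gt0 ?rho_gt0// powR_gt0// wealth_gt0. Qed.

(** The exponent [1 - theta] is nonpositive and [(1 - gamma) v] decreases in [v]. The assumption
    [1 <= theta] acts only through this monotonicity. *)
Lemma wt_homo (R : realType) (m : model R) (u v : R) : 1 <= theta m ->
  u <= v -> v < 0 -> wt m u <= wt m v.
Proof.
move=> th uv v0; rewrite ler_pM2l ?rho_gt0// powR_lt0_le ?subr_le0//.
  exact: wealth_gt0.
by rewrite ler_nM2l// subr_lt0 gamma_gt1.
Qed.

Lemma wt_continuous (R : realType) (m : model R) (v : R) : v < 0 ->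
  {for v, continuous (wt m)}.
Proof.
move=> v0; have w0 := wealth_gt0 m v0; apply: cvgM; first exact: cvg_cst.
apply: (@continuous_comp _ _ _ (fun x => (1 - gamma m) * x)
                               (fun w => w `^ (1 - theta m))).
  exact: mulrl_continuous.
apply: differentiable_continuous; apply/derivable1_diffP.
by apply: derivable_powR; rewrite in_itv/= andbT.
Qed.

Lemma kap_gt0 (R : realType) (m : model R) (c : R) : 0 < c -> 0 < kap m c.
Proof. by move=> c0; rewrite divr_gt0 ?powR_gt0 ?psi_inv_gt1. Qed.

Lemma kap_anti (R : realType) (m : model R) (c d : R) : 0 < c -> c <= d -> kap m d <= kap m c.
Proof.
move=> c0 cd; rewrite ler_pM2r ?invr_gt0 ?psi_inv_gt1// powR_lt0_le//.
by rewrite -oppr_ge0 opprB ltW ?psi_inv_gt1.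
Qed.

Lemma kap_tangent (R : realType) (m : model R) (c d : R) : 0 < c -> 0 < d ->
  kap m c - c `^ (- (psi m)^-1) * (d - c) <= kap m d.
Proof.
move=> c0 d0; rewrite /kap ler_pdivlMr ?psi_inv_gt1//.
have := @powR_tangent R ((psi m)^-1 - 1) c d (psi_inv_gt1 m) c0 d0.
rewrite opprB; apply: le_trans.
rewrite mulrBl divfK ?gt_eqF ?psi_inv_gt1// lerD2l lerN2.
have -> : 1 - (psi m)^-1 - 1 = - (psi m)^-1 by ring.
by rewrite [leRHS]mulrC mulrA.
Qed.

(** The cost vanishes as consumption grows. This yields near-optimal policies at zero backward
    slope, where no maximizer exists. *)
Lemma kap_small (R : realType) (m : model R) (a e : R) : 0 < e ->
  exists c, a <= c /\ kap m c <= e.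
Proof.
move=> e0; set s := (psi m)^-1 - 1; have s0 : 0 < s := psi_inv_gt1 m.
have es0 : 0 < e * s by rewrite mulr_gt0.
exists (Num.max a ((e * s) `^ (- s^-1))); split; first by rewrite le_max lexx.
apply: le_trans (_ : kap m ((e * s) `^ (- s^-1)) <= _).
  by apply: kap_anti; rewrite ?powR_gt0// le_max lexx orbT.
rewrite /kap -/s ler_pdivrMr// -powRrM -(opprB _ 1) -/s mulrNN mulVf ?gt_eqF//.
by rewrite powRr1// ltW.
Qed.

(** * Optimal consumption at a given slope *)

(** The root [c] of the first-order condition [q * c ^ (- 1 / psi) = p], hence the unconstrained
    maximizer of the concave function [flow m a p q]. *)
Definition copt (R : realType) (m : model R) (p q : R) : R := (q / p) `^ psi m.

Definition flow (R : realType) (m : model R) (a p q c : R) : R :=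
  (a - c) * p - q * kap m c.

Lemma kap_foc (R : realType) (m : model R) (c : R) : 0 < c ->
  kap m c = c * c `^ (- (psi m)^-1) / ((psi m)^-1 - 1).
Proof.
by move=> c0; rewrite /kap powRD ?(gt_eqF c0) ?implybT// powRr1 ?ltW.
Qed.

Lemma copt_gt0 (R : realType) (m : model R) (p q : R) : 0 < p -> 0 < q -> 0 < copt m p q.
Proof. by move=> p0 q0; rewrite powR_gt0// divr_gt0. Qed.

Lemma copt_foc (R : realType) (m : model R) (p q : R) : 0 < p -> 0 < q ->
  q * copt m p q `^ (- (psi m)^-1) = p.
Proof.
move=> p0 q0; rewrite /copt -powRrM mulrN divff ?gt_eqF ?psi_gt0//.
by rewrite powR_inv1 ?ltW ?divr_gt0// invf_div mulrC divfK ?gt_eqF.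
Qed.

Lemma copt_marginal (R : realType) (m : model R) (a q : R) : 0 < a -> 0 < q ->
  copt m (q * a `^ (- (psi m)^-1)) q = a.
Proof.
move=> a0 q0; rewrite /copt invfM mulrA divff ?gt_eqF// mul1r -powRN opprK.
by rewrite -{2}[psi m]invrK powRK ?gt_eqF ?invr_gt0 ?psi_gt0// ltW.
Qed.

Lemma copt_anti (R : realType) (m : model R) (p p' q : R) : 0 < p -> p <= p' -> 0 < q ->
  copt m p' q <= copt m p q.
Proof.
move=> p0 pp q0; have p'0 := lt_le_trans p0 pp.
apply: ge0_ler_powR; first exact: ltW (psi_gt0 m).
- by rewrite nnegrE ltW// divr_gt0.
- by rewrite nnegrE ltW// divr_gt0.
- by rewrite ler_pM2l// lef_pV2.
Qed.

Lemma copt_le (R : realType) (m : model R) (a p q : R) : 0 < a -> 0 < p -> 0 < q ->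
  (copt m p q <= a) = (q * a `^ (- (psi m)^-1) <= p).
Proof.
move=> a0 p0 q0; have psiV : - (psi m)^-1 <= 0 by rewrite oppr_le0 invr_ge0 ltW ?psi_gt0.
apply/idP/idP => h.
  rewrite -[leRHS](copt_foc m p0 q0) ler_pM2l//.
  by rewrite powR_lt0_le// copt_gt0.
by rewrite -[leRHS](copt_marginal m a0 q0) copt_anti// mulr_gt0// powR_gt0.
Qed.

Lemma copt_ge (R : realType) (m : model R) (a p q : R) : 0 < a -> 0 < p -> 0 < q ->
  (a <= copt m p q) = (p <= q * a `^ (- (psi m)^-1)).
Proof.
move=> a0 p0 q0; have psiV : - (psi m)^-1 <= 0 by rewrite oppr_le0 invr_ge0 ltW ?psi_gt0.
apply/idP/idP => h.
  by rewrite -[leLHS](copt_foc m p0 q0) ler_pM2l// powR_lt0_le.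
by rewrite -[leLHS](copt_marginal m a0 q0) copt_anti.
Qed.

(* Convexity of [kap]: a consumption level whose first-order condition points
   away from [d] does at least as well as [d]. *)
Lemma flow_le (R : realType) (m : model R) (a p q c d : R) :
  0 < c -> 0 < d -> 0 <= q ->
  0 <= (p - q * c `^ (- (psi m)^-1)) * (d - c) ->
  flow m a p q d <= flow m a p q c.
Proof.
move=> c0 d0 q0 h; have := ler_wpM2l q0 (kap_tangent m c0 d0).
rewrite /flow; move: h; move: (c `^ _) => t; move: (kap m c) (kap m d) => k l.
rewrite !(mulrBl, mulrBr) !mulrA => *; lra.
Qed.

Lemma flow_copt (R : realType) (m : model R) (a p q d : R) :
  0 < p -> 0 < q -> 0 < d -> flow m a p q d <= flow m a p q (copt m p q).
Proof.
move=> p0 q0 d0; apply: flow_le; rewrite ?copt_gt0 ?(ltW q0)//.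
by rewrite copt_foc// subrr mul0r.
Qed.

(** * Legendre form of the Hamiltonians *)

(** The exponents match because [psi (1 - theta) = vexp]; this links the closed formulas of [Ham]
    and [consumption] to [copt]. *)
Lemma wt_powR_psi (R : realType) (m : model R) (v : R) : v < 0 ->
  wt m v `^ psi m = rho m `^ psi m * ((1 - gamma m) * v) `^ vexp m.
Proof.
move=> v0; rewrite /wt powRM ?powR_ge0 ?(ltW (rho_gt0 m))// -powRrM.
congr (_ * _ `^ _); rewrite /vexp /theta.
have g1 : 1 - gamma m != 0 by rewrite lt_eqF// subr_lt0 gamma_gt1.
by have p0 : psi m != 0 by [rewrite gt_eqF ?psi_gt0]; field; apply/andP.
Qed.

(** Legendre duality. By the first-order condition [q * kap c = c p / (1 / psi - 1)], so both sides
    equal [a p - c p / (1 - psi)] with [a] the income flow and [c] the optimal consumption. *)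
Lemma Ham_copt (R : realType) (m : model R) (x y v p : R) : v < 0 -> 0 < p ->
  Ham m x y v p =
  (flow m (rate m * x + y) p (wt m v) (copt m p (wt m v)))%:E.
Proof.
move=> v0 p0; have q0 := wt_gt0 m v0; rewrite /Ham (ltW p0); congr EFin.
have s0 := psi_inv_gt1 m; have ps0 := psi_gt0 m; have ps1 := psi_lt1 m.
set q := wt m v in q0 *; set c := copt m p q; set a := _ + y.
have c0 : 0 < c by exact: copt_gt0.
have kc : q * kap m c = c * p / ((psi m)^-1 - 1).
  rewrite kap_foc//.
  have E (u w t s : R) : u * (w * t / s) = w * (u * t) / s by rewrite mulrA mulrCA !mulrA.
  by rewrite -[in RHS](copt_foc m p0 q0) -/c E.
have cp : c * p = rho m `^ psi m * p `^ (1 - psi m) * ((1 - gamma m) * v) `^ vexp m.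
  rewrite mulrAC -wt_powR_psi// -/q powRB ?(gt_eqF p0) ?implybT// powRr1 ?ltW//.
  rewrite /c /copt powRM ?invr_ge0 ?ltW// -powR_inv1 ?ltW// powRAC powR_inv1 ?powR_ge0//.
  by rewrite mulrAC mulrA.
rewrite /flow kc [(a - c) * p]mulrBl cp.
move: (rho m `^ _) (p `^ _) (_ `^ vexp m) => A B C.
field; apply/and3P; split; apply/negP => /eqP; lra.
Qed.

Lemma Ham0 (R : realType) (m : model R) (x y v : R) : Ham m x y v 0 = 0%:E.
Proof.
rewrite /Ham lexx powR0 ?mulr0 ?mul0r ?addr0//.
by rewrite subr_eq0 gt_eqF// psi_lt1.
Qed.

(** Consuming exactly the income gives zero drift and a value independent of [p], hence a lower
    bound for every [p]; it is attained at the slope for which income is the optimal consumption. *)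
Lemma Hmin_wt (R : realType) (m : model R) (x y v : R) : 0 < rate m * x + y -> v < 0 ->
  Hmin m x y v = (- (wt m v * kap m (rate m * x + y)))%:E.
Proof.
set a := _ + y => a0 v0; have q0 := wt_gt0 m v0.
have k0 := kap_gt0 m a0.
apply/eqP; rewrite eq_le; apply/andP; split.
  have pm0 : 0 < wt m v * a `^ (- (psi m)^-1) by rewrite mulr_gt0 ?powR_gt0.
  apply: ereal_inf_lbound; exists (wt m v * a `^ (- (psi m)^-1)) => //.
  by rewrite Ham_copt// copt_marginal// /flow subrr mul0r sub0r.
apply: le_ereal_inf_tmp => _ [p _ <-].
have [p0|p0|<-] := ltgtP 0 p.
- rewrite Ham_copt// lee_fin -/a; apply: le_trans (flow_copt m a p0 q0 a0).
  by rewrite /flow subrr mul0r sub0r.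
- by rewrite /Ham (leNgt 0 p) p0/= leey.
- by rewrite Ham0 lee_fin oppr_le0 mulr_ge0// ltW.
Qed.

Lemma pmin_wt (R : realType) (m : model R) (x y v : R) :
  pmin m x y v = wt m v * (rate m * x + y) `^ (- (psi m)^-1).
Proof. by rewrite /pmin /wt mulrAC. Qed.

(** The condition [pmin <= p] says that the unconstrained maximizer satisfies [c <= a]; otherwise
    the constraint binds at [a], which gives [Hmin]. *)
Lemma Hup_sup (R : realType) (m : model R) (x y v p : R) (a := rate m * x + y) :
  0 < a -> v < 0 ->
  exists h : R, [/\ Hup m x y v p = h%:E,
    forall c, 0 < c -> c <= a -> flow m a p (wt m v) c <= h &
    exists c, [/\ 0 < c, c <= a & flow m a p (wt m v) c = h]].
Proof.
move=> a0 v0; have q0 := wt_gt0 m v0; rewrite /Hup pmin_wt -/a.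
have [pp|pp] := leP.
  have p0 : 0 < p by apply: lt_le_trans pp; rewrite mulr_gt0 ?powR_gt0.
  rewrite Ham_copt//; eexists; split; [reflexivity| |].
    by move=> c c0 _; exact: flow_copt.
  by exists (copt m p (wt m v)); rewrite copt_gt0 ?copt_le.
rewrite Hmin_wt//; eexists; split; [reflexivity| |].
  move=> c c0 ca; apply: (@le_trans _ _ (flow m a p (wt m v) a)).
    apply: flow_le; rewrite ?(ltW q0)// nmulr_rge0 ?subr_lt0// subr_le0//.
  by rewrite /flow subrr mul0r sub0r.
by exists a; rewrite /flow subrr mul0r sub0r.
Qed.

(** Mirror image of [Hup_sup] for [c >= a]. At [p = 0] the supremum is only approached as [c] tends
    to infinity, so attainment is claimed for [0 < p] and approximation in general. *)
Lemma Hdown_sup (R : realType) (m : model R) (x y v p : R) (a := rate m * x + y) :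
  0 < a -> v < 0 -> 0 <= p ->
  exists h : R, [/\ Hdown m x y v p = h%:E,
    forall c, a <= c -> flow m a p (wt m v) c <= h,
    0 < p -> exists c, a <= c /\ flow m a p (wt m v) c = h &
    forall e, 0 < e -> exists c, a <= c /\ h - e < flow m a p (wt m v) c].
Proof.
move=> a0 v0; have q0 := wt_gt0 m v0.
rewrite le_eqVlt => /predU1P[<-|p0].
  rewrite /Hdown ltxx pmin_wt -/a mulr_ge0 ?powR_ge0 ?ltW// Ham0.
  exists 0; split => //.
  - move=> c ac; rewrite /flow mulr0 sub0r oppr_le0 mulr_ge0 ?(ltW q0)//.
    by rewrite ltW// kap_gt0// (lt_le_trans a0).
  - move=> e e0; have e20 : 0 < e / 2 / wt m v by rewrite !divr_gt0.
    have [c [ac kc]] := kap_small m a e20; exists c; split => //; rewrite /flow mulr0 !sub0r ltrN2.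
    move: kc; rewrite ler_pdivlMr// mulrC => /le_lt_trans; apply.
    by rewrite gtr_pMr// invf_lt1// ltr1n.
have [h [E1 E2 [c [ac E3]]]] : exists h : R, [/\ Hdown m x y v p = h%:E,
    forall c, a <= c -> flow m a p (wt m v) c <= h &
    exists c, a <= c /\ flow m a p (wt m v) c = h].
  rewrite /Hdown ltNge (ltW p0)/= pmin_wt -/a.
  have [pp|pp] := leP.
    rewrite Ham_copt//; eexists; split; [reflexivity| |].
      by move=> c ac; apply: flow_copt => //; exact: lt_le_trans ac.
    by exists (copt m p (wt m v)); rewrite copt_ge.
  rewrite Hmin_wt//; eexists; split; [reflexivity| |].
    move=> c ca; apply: (@le_trans _ _ (flow m a p (wt m v) a)).
      apply: flow_le; rewrite ?(ltW q0) ?(lt_le_trans a0)//.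
      by rewrite mulr_ge0// subr_ge0// ltW.
    by rewrite /flow subrr mul0r sub0r.
  by exists a; rewrite /flow subrr mul0r sub0r.
exists h; split=> // [_|e e0]; first by exists c.
by exists c; rewrite E3 ltrBlDr ltrDl.
Qed.

(** * Policies, gains and supersolutions of (D) *)

(** The two boundary equalities give zero drift, hence zero weight, to the meaningless difference at
    each end of the grid. *)
Definition admissible (R : realType) (m : model R) (i : 'I_(nI m).+1) (j : 'I_2)
    (cF cB : R) : Prop :=
  [/\ 0 < cF, cF <= cbar i j, cbar i j <= cB,
      i = ord0 -> cB = cbar i j & i = ord_max -> cF = cbar i j].

Definition gain (R : realType) (m : model R) (V : grid m) (i : 'I_(nI m).+1) (j : 'I_2)
    (cF cB : R) : R :=
  (cbar i j - cF) * Dplus V i j + (cbar i j - cB) * Dminus V i j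
  - wt m (V i j) * (kap m cF + kap m cB - kap m (cbar i j)).

Definition residual (R : realType) (m : model R) (V : grid m) : grid m :=
  fun i j => rho m / theta m * V i j - jump V i j.

Definition supersolution (R : realType) (m : model R) (V : grid m) : Prop :=
  forall i j cF cB, admissible i j cF cB -> gain V i j cF cB <= residual V i j.

Lemma ord_max_neq0 (R : realType) (m : model R) : (ord_max : 'I_(nI m).+1) != ord0.
Proof. by rewrite -val_eqE/= -lt0n nI_gt0. Qed.

Lemma gainE (R : realType) (m : model R) (V : grid m) i j cF cB :
  gain V i j cF cB = flow m (cbar i j) (Dplus V i j) (wt m (V i j)) cF +
    flow m (cbar i j) (Dminus V i j) (wt m (V i j)) cB + wt m (V i j) * kap m (cbar i j).
Proof. rewrite /gain /flow; ring. Qed.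

Lemma flow_cbar (R : realType) (m : model R) (a p q : R) : flow m a p q a = - (q * kap m a).
Proof. by rewrite /flow subrr mul0r sub0r. Qed.

(** By [gainE] the gain separates into a flow in [cF] and a flow in [cB], which are maximized
    independently; subtracting [Hmin] removes the doubly counted cost of [cbar]. *)
Lemma discreteH_sup (R : realType) (m : model R) (V : grid m) i j :
  negative_grid V -> (i != ord0 -> 0 <= Dminus V i j) ->
  exists h : R, [/\ discreteH i j (V i j) (Dplus V i j) (Dminus V i j) = h%:E,
    forall cF cB, admissible i j cF cB -> gain V i j cF cB <= h,
    (i != ord0 -> 0 < Dminus V i j) ->
      exists cF cB, admissible i j cF cB /\ gain V i j cF cB = h &
    forall e, 0 < e -> exists cF cB,
      admissible i j cF cB /\ h - e < gain V i j cF cB].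
Proof.
move=> V0 pB0; have a0 := cbar_gt0 i j; rewrite /discreteH.
have [hU [-> hUle [c [c0 cle cE]]]] := @Hup_sup R m _ _ _ (Dplus V i j) a0 (V0 i j).
have [i0|i0] := eqVneq i ord0.
  have adm : admissible i j c (cbar i j).
    by split=> //; rewrite i0 => h; have := ord_max_neq0 m; rewrite -h eqxx.
  have gE : gain V i j c (cbar i j) = hU by rewrite gainE flow_cbar cE addrNK.
  exists hU; split=> // [cF cB [cF0 cFle _ /(_ i0) -> _]|_|e e0].
  - by rewrite gainE flow_cbar addrNK hUle.
  - by exists c, (cbar i j).
  - by exists c, (cbar i j); rewrite gE ltrBlDr ltrDl.
have [hD [-> hDle hDpos hDeps]] := @Hdown_sup R m _ _ _ (Dminus V i j) a0 (V0 i j) (pB0 i0).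
have [i1|i1] := eqVneq i ord_max.
  have adm d : cbar i j <= d -> admissible i j (cbar i j) d.
    by move=> ad; split=> // /eqP; rewrite (negbTE i0).
  have gE d : gain V i j (cbar i j) d = flow m (cbar i j) (Dminus V i j) (wt m (V i j)) d.
    by rewrite gainE flow_cbar addrAC addNr add0r.
  exists hD; split=> // [cF cB [_ _ cBge _ /(_ i1) ->]|/(_ isT) /hDpos[d [ad dE]]|e /hDeps[d [ad dE]]].
  - by rewrite gE hDle.
  - by exists (cbar i j), d; split; [exact: adm|rewrite gE].
  - by exists (cbar i j), d; split; [exact: adm|rewrite gE].
have adm d : cbar i j <= d -> admissible i j c d.
  by move=> ad; split=> // /eqP; rewrite ?(negbTE i0) ?(negbTE i1).
exists (hU + hD + wt m (V i j) * kap m (cbar i j)); split.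
- by rewrite Hmin_wt//= -[in RHS](opprK (wt m (V i j) * _)).
- move=> cF cB [cF0 cFle cBge _ _]; rewrite gainE lerD2r lerD//.
  + exact: hUle.
  + exact: hDle.
- move=> /(_ isT) /hDpos[d [ad dE]]; exists c, d; split; first exact: adm.
  by rewrite gainE cE dE.
- move=> e /hDeps[d [ad dE]]; exists c, d; split; first exact: adm.
  by rewrite gainE cE addrAC ltrD2r -addrA ltrD2l.
Qed.

Lemma discreteH_pinfty (R : realType) (m : model R) (V : grid m) i j :
  negative_grid V -> i != ord0 -> Dminus V i j < 0 ->
  discreteH i j (V i j) (Dplus V i j) (Dminus V i j) = +oo%E.
Proof.
move=> V0 i0 p0; have a0 := cbar_gt0 i j; rewrite /discreteH (negbTE i0).
have [hU [-> _ _]] := @Hup_sup R m _ _ _ (Dplus V i j) a0 (V0 i j).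
by rewrite /Hdown p0 Hmin_wt//; case: ifP.
Qed.

Lemma HJB_Dminus_ge0 (R : realType) (m : model R) (V : grid m) i j :
  discrete_HJB V -> i != ord0 -> 0 <= Dminus V i j.
Proof.
move=> [V0 /(_ i j) E] i0; rewrite leNgt; apply/negP => p0.
by rewrite discreteH_pinfty in E.
Qed.

Lemma HJB_supersolution (R : realType) (m : model R) (V : grid m) :
  discrete_HJB V -> supersolution V.
Proof.
move=> HV i j cF cB adm.
have [h [hE hle _ _]] := discreteH_sup HV.1 (@HJB_Dminus_ge0 _ _ _ i j HV).
have := HV.2 i j; rewrite hE => -[rE].
by rewrite /residual rE addrK hle.
Qed.

Lemma HJB_attained (R : realType) (m : model R) (V : grid m) i j :
  discrete_HJB V -> (i != ord0 -> 0 < Dminus V i j) ->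
  exists cF cB, admissible i j cF cB /\ gain V i j cF cB = residual V i j.
Proof.
move=> HV p0.
have [h [hE _ /(_ p0)[cF [cB [adm gE]]] _]] :=
  discreteH_sup HV.1 (@HJB_Dminus_ge0 _ _ _ i j HV).
exists cF, cB; split => //; have := HV.2 i j; rewrite hE => -[rE].
by rewrite /residual rE addrK.
Qed.

(** With a negative backward slope, a large [cB] would make the gain arbitrarily large. *)
Lemma supersolution_Dminus_ge0 (R : realType) (m : model R) (V : grid m) i j :
  negative_grid V -> supersolution V -> i != ord0 -> 0 <= Dminus V i j.
Proof.
move=> V0 SV i0; rewrite leNgt; apply/negP => p0.
have q0 := wt_gt0 m (V0 i j); have a0 := cbar_gt0 i j.
have k0 := kap_gt0 m a0.
set r := residual V i j.
(* The backward drift at [d] contributes exactly [t], which exceeds the residual plus the largest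
   possible cost [wt * kap cbar]. *)
pose t := `|r + wt m (V i j) * kap m (cbar i j)| + 1.
have t0 : 0 < t by rewrite ltr_wpDl.
pose d := cbar i j + t / - Dminus V i j.
have ad : cbar i j <= d by rewrite lerDl ltW// divr_gt0// oppr_gt0.
have adm : admissible i j (cbar i j) d by split=> // /eqP; rewrite (negbTE i0).
have := SV _ _ _ _ adm; rewrite -/r gainE flow_cbar {1}/flow.
have -> : (cbar i j - d) * Dminus V i j = t.
  by rewrite /d opprD addNKr mulNr -mulrN divfK// oppr_eq0 lt_eqF.
have kd := ler_wpM2l (ltW q0) (kap_anti m a0 ad).
have := ler_norm (r + wt m (V i j) * kap m (cbar i j)).
by rewrite /t; lra.
Qed.

Lemma HJB_of_sup (R : realType) (m : model R) (V : grid m) :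
  negative_grid V -> supersolution V ->
  (forall i j e, 0 < e -> exists cF cB,
      admissible i j cF cB /\ residual V i j - e < gain V i j cF cB) ->
  discrete_HJB V.
Proof.
move=> V0 SV sup; split=> // i j.
have [h [-> hle _ heps]] :=
  discreteH_sup V0 (@supersolution_Dminus_ge0 _ _ _ i j V0 SV).
rewrite -EFinD; congr EFin; apply/eqP; rewrite -subr_eq -/(residual V i j).
rewrite eq_le; apply/andP; split; apply/ler_addgt0Pl => e e0.
  have [cF [cB [/hle gh /ltW/le_trans/(_ gh)]]] := sup i j e e0.
  by rewrite lerBlDl.
have [cF [cB [/SV gh /ltW/le_trans/(_ gh)]]] := heps e e0.
by rewrite lerBlDl.
Qed.

(** * Comparison principle for a fixed policy *)

(** At a node maximizing [U - W] with a positive maximum, the upwind drift terms, the jump and, by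
    monotonicity of [wt], the cost are all no larger at [U] in their contribution than at [W],
    contradicting the sign of [rho / theta * (U - W)]. *)
Lemma policy_comparison (R : realType) (m : model R) (cF cB U W : grid m) :
  1 <= theta m -> negative_grid U -> negative_grid W ->
  (forall i j, admissible i j (cF i j) (cB i j)) ->
  (forall i j, residual U i j <= gain U i j (cF i j) (cB i j)) ->
  (forall i j, gain W i j (cF i j) (cB i j) <= residual W i j) ->
  forall i j, U i j <= W i j.
Proof.
move=> th U0 W0 adm subU supW i0 j0.
pose D (k : 'I_(nI m).+1 * 'I_2) := U k.1 k.2 - W k.1 k.2.
have [[i j] _ maxD] := @Order.TotalTheory.arg_maxP _ _ _ (i0, j0) xpredT D isT.
rewrite -subr_le0; apply: (le_trans (maxD (i0, j0) isT)).
rewrite leNgt /D/=; apply/negP => pos.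
have Dle i' j' : U i' j' - W i' j' <= U i j - W i j := maxD (i', j') isT.
have dxV0 : 0 <= (dx m)^-1 by rewrite invr_ge0 ltW ?dx_gt0.
have [cF0 cFle cBge _ _] := adm i j.
have plus : (cbar i j - cF i j) * Dplus U i j <= (cbar i j - cF i j) * Dplus W i j.
  rewrite ler_wpM2l ?subr_ge0// ler_wpM2r//.
  (* At the right end [inord i.+1] falls back to some grid node; maximality covers every node, so
     this case is harmless. *)
  by have := Dle (inord i.+1) j; lra.
have minus : (cbar i j - cB i j) * Dminus U i j <= (cbar i j - cB i j) * Dminus W i j.
  rewrite ler_wnM2l ?subr_le0// ler_wpM2r//.
  by have := Dle (inord i.-1) j; lra.
have A0 : 0 <= kap m (cF i j) + kap m (cB i j) - kap m (cbar i j).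
  have := kap_anti m cF0 cFle; have := kap_gt0 m (lt_le_trans (cbar_gt0 i j) cBge); lra.
have wle : wt m (W i j) <= wt m (U i j) by rewrite wt_homo// -subr_ge0 ltW.
have qle := ler_wpM2r A0 wle.
have jle : jump U i j <= jump W i j.
  rewrite ler_pM2l ?lam_gt0//; have := Dle i (rev_ord j); lra.
have rpos : 0 < rho m / theta m * (U i j - W i j).
  by rewrite !mulr_gt0 ?invr_gt0 ?theta_gt0 ?rho_gt0.
have := subU i j; have := supW i j; rewrite /gain /residual.
rewrite mulrBr in rpos; lra.
Qed.

(** * The explicit supersolution [Vcheck] *)

(** When both drifts see the same slope, splitting consumption gains nothing: one of [cF], [cB] lies
    on the far side of [a] from the optimum and by concavity does no better than [a], whose flow
    cancels [q * kap a]. *)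
Lemma flow_two_sided (R : realType) (m : model R) (a p q cF cB : R) :
  0 < p -> 0 < q -> 0 < cF -> 0 < a -> cF <= a -> a <= cB ->
  flow m a p q cF + flow m a p q cB + q * kap m a <= flow m a p q (copt m p q).
Proof.
move=> p0 q0 cF0 a0 cFle cBge; have cB0 := lt_le_trans a0 cBge.
have fa : q * kap m a = - flow m a p q a by rewrite flow_cbar opprK.
rewrite fa lerBlDr; have [h|h] := leP (copt m p q) a.
- apply: lerD; first exact: flow_copt.
  apply: flow_le; rewrite ?(ltW q0)// mulr_ge0 ?subr_ge0//.
  by rewrite -copt_le.
- rewrite addrC; apply: lerD; first exact: flow_copt.
  apply: flow_le; rewrite ?(ltW q0)// mulr_le0 ?subr_le0//.
  by rewrite -copt_ge// ltW.
Qed.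

Lemma bconst_gt0 (R : realType) (m : model R) : 0 < bconst m.
Proof.
rewrite mulr_gt0 ?rho_gt0// powR_gt0// divr_gt0 ?rho_gt0//.
by rewrite addr_gt0 ?rate_gt0// mulr_gt0 ?psi_gt0// subr_gt0 rate_lt_rho.
Qed.

(** The equation that determines [b]; its right-hand side is the propensity to consume out of total
    wealth. *)
Lemma bconst_powR (R : realType) (m : model R) :
  rho m `^ psi m * bconst m `^ (1 - psi m) = rate m + psi m * (rho m - rate m).
Proof.
have r0 := rho_gt0 m; have p1 : 1 - psi m != 0 by rewrite subr_eq0 gt_eqF ?psi_lt1.
have M0 : 0 < rate m + psi m * (rho m - rate m).
  by rewrite addr_gt0 ?rate_gt0// mulr_gt0 ?psi_gt0// subr_gt0 rate_lt_rho.
rewrite /bconst powRM ?powR_ge0 ?(ltW r0)// -powRrM mulVf// powRr1; last first.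
  by rewrite ltW// divr_gt0.
rewrite mulrA -powRD ?(gt_eqF r0) ?implybT//.
rewrite (_ : psi m + (1 - psi m) = 1); last by ring.
by rewrite powRr1 ?(ltW r0)// mulrC divfK ?gt_eqF.
Qed.

(** Total wealth: assets plus the high income capitalized at the interest rate. *)
Definition zcheck (R : realType) (m : model R) (i : 'I_(nI m).+1) : R :=
  xgrid i + income m ord_max / rate m.

(** The derivative of [vcheck]. *)
Definition pcheck (R : realType) (m : model R) (z : R) : R :=
  bconst m * (bconst m * z) `^ (- gamma m).

Definition vcheck (R : realType) (m : model R) (z : R) : R :=
  (bconst m * z) `^ (1 - gamma m) / (1 - gamma m).

Lemma rate_zcheck (R : realType) (m : model R) (i : 'I_(nI m).+1) :
  rate m * zcheck i = rate m * xgrid i + income m ord_max.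
Proof. by rewrite mulrDr mulrCA divff ?mulr1// gt_eqF ?rate_gt0. Qed.

Lemma zcheck_gt0 (R : realType) (m : model R) (i : 'I_(nI m).+1) : 0 < zcheck i.
Proof.
rewrite -(pmulr_rgt0 _ (rate_gt0 m)) rate_zcheck.
exact: cbar_gt0.
Qed.

Lemma one_gamma_lt0 (R : realType) (m : model R) : 1 - gamma m < 0.
Proof. by rewrite subr_lt0 gamma_gt1. Qed.

Lemma vcheck_lt0 (R : realType) (m : model R) (z : R) : 0 < z -> vcheck m z < 0.
Proof.
move=> z0; rewrite /vcheck nmulr_llt0 ?invr_lt0 ?one_gamma_lt0//.
by rewrite powR_gt0// mulr_gt0 ?bconst_gt0.
Qed.

Lemma vcheck_tangent (R : realType) (m : model R) (z z' : R) : 0 < z -> 0 < z' ->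
  vcheck m z' <= vcheck m z + pcheck m z * (z' - z).
Proof.
move=> z0 z'0; have b0 := bconst_gt0 m; have g0 := one_gamma_lt0 m.
have s0 : 0 < gamma m - 1 by rewrite -opprB oppr_gt0.
have := powR_tangent s0 (mulr_gt0 b0 z0) (mulr_gt0 b0 z'0).
rewrite opprB (_ : 1 - gamma m - 1 = - gamma m); last by ring.
move=> h; rewrite /vcheck ler_ndivrMr//; apply: le_trans h.
rewrite mulrDl divfK ?lt_eqF// lerD2l /pcheck -mulrBr le_eqVlt; apply/orP; left.
by apply/eqP; ring.
Qed.

Lemma pcheck_gt0 (R : realType) (m : model R) (z : R) : 0 < z -> 0 < pcheck m z.
Proof. by move=> z0; rewrite mulr_gt0 ?bconst_gt0// powR_gt0// mulr_gt0 ?bconst_gt0. Qed.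

Lemma copt_check (R : realType) (m : model R) (z : R) : 0 < z ->
  copt m (pcheck m z) (wt m (vcheck m z)) = (rate m + psi m * (rho m - rate m)) * z.
Proof.
move=> z0; have b0 := bconst_gt0 m; have r0 := rho_gt0 m; have ps0 := psi_gt0 m.
have g0 := one_gamma_lt0 m; have bz0 : 0 < bconst m * z by rewrite mulr_gt0.
(* The exponents combine through [(1 - gamma) (1 - theta) = 1 / psi - gamma]. *)
have -> : wt m (vcheck m z) = rho m * (bconst m * z) `^ ((psi m)^-1 - gamma m).
  rewrite /wt /vcheck; congr (_ * _).
  rewrite mulrC divfK ?lt_eqF// -powRrM; congr (_ `^ _); rewrite /theta.
  by field; apply/andP; split; apply/negP => /eqP; lra.
rewrite /copt /pcheck invfM mulrACA -powRN opprK -powRD; last first.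
  by rewrite (gt_eqF bz0) implybT.
rewrite subrK (@powRM _ (_ / _)) ?powR_ge0 ?divr_ge0 ?(ltW r0) ?(ltW b0)//.
rewrite -powRrM mulVf ?gt_eqF// powRr1 ?(ltW bz0)// mulrA; congr (_ * _).
rewrite -bconst_powR powRM ?invr_ge0 ?(ltW r0) ?(ltW b0)// -mulrA; congr (_ * _).
rewrite powRB; last by rewrite (gt_eqF b0) implybT.
rewrite powRr1 ?(ltW b0)// mulrC; congr (_ * _).
by rewrite -powR_inv1 ?(ltW b0)// powRAC powR_inv1 ?powR_ge0.
Qed.

(** [vcheck] solves exactly the continuous equation with constant high income, whose drift is
    [rate * z - c]. *)
Lemma vcheck_HJB (R : realType) (m : model R) (z : R) : 0 < z ->
  flow m (rate m * z) (pcheck m z) (wt m (vcheck m z))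
    (copt m (pcheck m z) (wt m (vcheck m z))) = rho m / theta m * vcheck m z.
Proof.
move=> z0; have p0 := pcheck_gt0 m z0; have q0 := wt_gt0 m (vcheck_lt0 m z0).
have b0 := bconst_gt0 m; have bz0 : 0 < bconst m * z by rewrite mulr_gt0.
have g0 := one_gamma_lt0 m; have s0 := psi_inv_gt1 m.
rewrite /flow kap_foc ?copt_gt0//.
have E (u w t s : R) : u * (w * t / s) = w * (u * t) / s by rewrite mulrA mulrCA !mulrA.
rewrite E copt_foc// copt_check//.
have -> : vcheck m z = pcheck m z * z / (1 - gamma m).
  rewrite /vcheck /pcheck; congr (_ / _).
  rewrite powRD ?(gt_eqF bz0) ?implybT// powRr1 ?(ltW bz0)//; ring.
rewrite /theta; move: (pcheck m z) => p.
have h1 : psi m != 0 by rewrite gt_eqF ?psi_gt0.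
have h2 : psi m - 1 != 0 by rewrite subr_eq0 lt_eqF ?psi_lt1.
have h3 : 1 - psi m != 0 by rewrite subr_eq0 gt_eqF ?psi_lt1.
have h4 : 1 - gamma m != 0 by rewrite lt_eqF.
by field; rewrite h4 h1 h2 mulN1r h3.
Qed.

Lemma xgrid_next (R : realType) (m : model R) (i : 'I_(nI m).+1) : i != ord_max ->
  xgrid (inord i.+1 : 'I_(nI m).+1) = xgrid i + dx m.
Proof.
move=> i1; have iI : (i < nI m)%N by rewrite ltn_neqAle -ltnS ltn_ord -val_eqE/= in i1 *; rewrite i1.
by rewrite /xgrid inordK ?ltnS// -natr1 mulrDl mul1r addrA.
Qed.

Lemma xgrid_prev (R : realType) (m : model R) (i : 'I_(nI m).+1) : i != ord0 ->
  xgrid (inord i.-1 : 'I_(nI m).+1) = xgrid i - dx m.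
Proof.
move=> i0; have i1 : (0 < i)%N by rewrite lt0n.
rewrite /xgrid inordK ?(leq_ltn_trans (leq_pred _))// -[in RHS](prednK i1) -natr1.
by rewrite mulrDl mul1r addrA addrK.
Qed.

(** By concavity of [vcheck], forward differences lie below [pcheck] and backward ones above it, so
    both may be replaced by the single slope [pcheck]. Then [flow_two_sided] and [vcheck_HJB]
    conclude; the jump vanishes because both income states share one value. *)
Lemma Vcheck_supersolution (R : realType) (m : model R) :
  negative_grid (Vcheck m) /\ supersolution (Vcheck m).
Proof.
have VE i j : Vcheck m i j = vcheck m (zcheck i) by [].
split=> [i j|i j cF cB [cF0 cFle cBge cB0 cFI]]; first by rewrite VE vcheck_lt0// zcheck_gt0.
have z0 := zcheck_gt0 i; have p0 := pcheck_gt0 m z0.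
have q0 := wt_gt0 m (vcheck_lt0 m z0).
have Dp (k : 'I_(nI m).+1) : (zcheck k - zcheck i) = xgrid k - xgrid i by rewrite /zcheck; ring.
have -> : residual (Vcheck m) i j = rho m / theta m * vcheck m (zcheck i).
  by rewrite /residual /jump !VE subrr mulr0 subr0.
rewrite -vcheck_HJB//.
apply: le_trans (_ : flow m (cbar i j) (pcheck m (zcheck i)) (wt m (vcheck m (zcheck i)))
    (copt m (pcheck m (zcheck i)) (wt m (vcheck m (zcheck i)))) <= _); last first.
  rewrite /flow lerD2r ler_pM2r// lerD2r rate_zcheck lerD2l; exact: le_income_max.
apply: le_trans (flow_two_sided m p0 q0 cF0 (cbar_gt0 i j) cFle cBge).
rewrite gainE VE lerD2r; apply: lerD; rewrite /flow lerD2r.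
  have [/cFI ->|i1] := eqVneq i ord_max; first by rewrite subrr !mul0r.
  rewrite ler_wpM2l ?subr_ge0// /Dplus !VE ler_pdivrMr ?dx_gt0//.
  have := vcheck_tangent m z0 (zcheck_gt0 (inord i.+1 : 'I_(nI m).+1)).
  by rewrite Dp xgrid_next// addrAC subrr add0r lerBlDl.
have [/cB0 ->|i0] := eqVneq i ord0; first by rewrite subrr !mul0r.
rewrite ler_wnM2l ?subr_le0// /Dminus !VE ler_pdivlMr ?dx_gt0//.
have := vcheck_tangent m z0 (zcheck_gt0 (inord i.-1 : 'I_(nI m).+1)).
by rewrite Dp xgrid_prev// addrAC subrr add0r mulrN; lra.
Qed.

Lemma Vcheck_le_max (R : realType) (m : model R) i j k : Vcheck m i j <= Vcheck m ord_max k.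
Proof.
have z0 := zcheck_gt0 i; have b0 := bconst_gt0 m.
rewrite /Vcheck ler_nM2r ?invr_lt0 ?one_gamma_lt0//.
apply: powR_lt0_le; [exact: ltW (one_gamma_lt0 m)|by rewrite mulr_gt0|].
by rewrite ler_pM2l// lerD2r xgrid_homo// -ltnS.
Qed.

(** * Existence by Perron's method *)

Lemma wt_near (R : realType) (m : model R) (v e : R) : v < 0 -> 0 < e ->
  exists2 d, 0 < d & forall u, `|v - u| < d -> `|wt m v - wt m u| < e.
Proof.
move=> v0 e0; have /cvgrPdist_lt/(_ e e0)/nbhs_ballP[d d0 dP] := @wt_continuous R m v v0.
by exists d => // u uv; exact: dP.
Qed.

(** Changes at the neighbours and in the other income state have the favourable sign, so only the
    change [t] at the node itself costs anything. *)
Lemma grid_perturb (R : realType) (m : model R) (L H : grid m) i j (t := H i j - L i j) :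
  (forall i j, L i j <= H i j) ->
  [/\ Dplus L i j <= Dplus H i j + t / dx m,
      Dminus H i j - t / dx m <= Dminus L i j &
      residual H i j <= residual L i j + (rho m / theta m + lam m j) * t].
Proof.
move=> LH; have dxV0 : 0 <= (dx m)^-1 by rewrite invr_ge0 ltW ?dx_gt0.
split.
- rewrite /Dplus -mulrDl ler_wpM2r// /t; have := LH (inord i.+1) j; lra.
- rewrite /Dminus -mulrBl ler_wpM2r// /t; have := LH (inord i.-1) j; lra.
- have := ler_wpM2l (ltW (lam_gt0 m j)) (LH i (rev_ord j)).
  by rewrite /residual /jump /t !(mulrDl, mulrBr, mulrDr); lra.
Qed.

Lemma kap_sum_ge0 (R : realType) (m : model R) i j cF cB : @admissible R m i j cF cB ->
  0 < kap m cF + kap m cB - kap m (cbar i j).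
Proof.
move=> [cF0 cFle cBge _ _].
have := kap_anti m cF0 cFle; have := kap_gt0 m (lt_le_trans (cbar_gt0 i j) cBge); lra.
Qed.

Lemma cbar_ge_min (R : realType) (m : model R) (i : 'I_(nI m).+1) j :
  cbar (ord0 : 'I_(nI m).+1) ord0 <= cbar i j.
Proof.
apply: lerD; last exact: ge_income_min.
by rewrite ler_wpM2l ?xgrid_homo// ltW ?rate_gt0.
Qed.

(** A sufficiently negative constant is a subsolution for the zero-drift policy, and comparison puts
    it below every supersolution. *)
Lemma supersolution_lbound (R : realType) (m : model R) : 1 <= theta m ->
  exists K : R, forall V : grid m, negative_grid V -> supersolution V ->
    forall i j, - K <= V i j.
Proof.
move=> th; have rt0 : 0 < rho m / theta m by rewrite divr_gt0 ?rho_gt0 ?theta_gt0.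
pose c0 := cbar (ord0 : 'I_(nI m).+1) ord0.
(* The bound [1 <= K] gives [wt (- K) <= wt (- 1)], and [c0] is the smallest income flow, so a
   single [K] serves all nodes. *)
pose K := Num.max 1 (wt m (- 1) * kap m c0 / (rho m / theta m)).
have K1 : 1 <= K by rewrite le_max lexx.
have KL : wt m (- 1) * kap m c0 / (rho m / theta m) <= K by rewrite le_max lexx orbT.
exists K => V V0 SV.
have adm (i : 'I_(nI m).+1) j : admissible i j (cbar i j) (cbar i j).
  by split=> //; exact: cbar_gt0.
apply: (@policy_comparison R m (fun i j => cbar i j) (fun i j => cbar i j) (fun _ _ => - K)) => //.
- by move=> i j; lra.
- move=> i j; rewrite /gain /residual /jump !subrr !mul0r mulr0 subr0 addr0 sub0r addrK.
  rewrite mulrN lerN2 [leRHS]mulrC -ler_pdivrMr//; apply: le_trans KL.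
  rewrite ler_pM2r ?invr_gt0//; apply: ler_pM.
  + by rewrite ltW// wt_gt0//; lra.
  + by rewrite ltW// kap_gt0 ?cbar_gt0.
  + by apply: wt_homo => //; lra.
  + by rewrite kap_anti ?cbar_ge_min// cbar_gt0.
- by move=> i j; exact: SV.
Qed.

Definition minimal_supersolution (R : realType) (m : model R) : grid m :=
  fun i j => inf [set V i j | V in [set V : grid m | negative_grid V /\ supersolution V]].
Arguments minimal_supersolution {R} m _ _.

Lemma has_inf_supersolutions (R : realType) (m : model R) i j : 1 <= theta m ->
  has_inf [set V i j | V in [set V : grid m | negative_grid V /\ supersolution V]].
Proof.
move=> th; split.
  by exists (Vcheck m i j), (Vcheck m) => //; exact: Vcheck_supersolution.
have [K Kle] := supersolution_lbound th; exists (- K) => _ [V [V0 SV] <-]; exact: Kle.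
Qed.

Lemma minimal_supersolution_le (R : realType) (m : model R) (V : grid m) i j :
  1 <= theta m -> negative_grid V -> supersolution V ->
  minimal_supersolution m i j <= V i j.
Proof.
move=> th V0 SV; apply: ge_inf; first exact: (has_inf_supersolutions i j th).2.
by exists V.
Qed.

Lemma minimal_supersolution_lt0 (R : realType) (m : model R) :
  1 <= theta m -> negative_grid (minimal_supersolution m).
Proof.
move=> th i j; have [Vc0 SVc] := Vcheck_supersolution m.
exact: le_lt_trans (minimal_supersolution_le i j th Vc0 SVc) (Vc0 i j).
Qed.

(** For a fixed node and policy, a supersolution nearly attaining the infimum at that node suffices:
    it lies above the infimum elsewhere, so [grid_perturb] bounds the error. *)
Lemma minimal_supersolutionP (R : realType) (m : model R) :
  1 <= theta m -> supersolution (minimal_supersolution m).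
Proof.
move=> th i j cF cB adm; have [cF0 cFle cBge _ _] := adm.
set U := minimal_supersolution m.
have U0 : U i j < 0 by exact: minimal_supersolution_lt0.
have rt0 : 0 < rho m / theta m by rewrite divr_gt0 ?rho_gt0 ?theta_gt0.
set A := kap m cF + kap m cB - kap m (cbar i j).
have A0 : 0 < A by exact: kap_sum_ge0 adm.
(* The total coefficient of the gap [t]: the residual contributes the first two terms, and the two
   drifts add up to [cB - cF]. *)
pose C := rho m / theta m + lam m j + (cB - cF) / dx m.
have C0 : 0 < C.
  rewrite ltr_wpDr ?addr_gt0 ?lam_gt0// divr_ge0 ?(ltW (dx_gt0 m))// subr_ge0.
  exact: le_trans cBge.
apply/ler_addgt0Pl => e e0.
have e1 : 0 < e / 2 / A by rewrite !divr_gt0.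
have e2 : 0 < e / 2 / C by rewrite !divr_gt0.
have [d d0 dP] := wt_near m U0 e1.
have dm : 0 < Num.min d (e / 2 / C) by rewrite lt_min d0.
have [_ [V [V0 SV] <-] Vlt] := inf_adherent dm (has_inf_supersolutions i j th).
have UV k l : U k l <= V k l by exact: minimal_supersolution_le.
have [] := grid_perturb i j UV.
rewrite -/(U i j) in Vlt; set t := V i j - U i j => Dp Dm Rle.
have t0 : 0 <= t by rewrite subr_ge0.
have : t < Num.min d (e / 2 / C) by rewrite ltrBlDl.
rewrite lt_min => /andP[td te].
have wV : wt m (V i j) - wt m (U i j) <= e / 2 / A.
  have : `|U i j - V i j| < d by rewrite distrC ger0_norm.
  by move=> /dP; rewrite distrC => /ltW; apply: le_trans; exact: ler_norm.
have := ler_wpM2r (ltW A0) wV; rewrite divfK ?(gt_eqF A0)// => wVA.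
move: te; rewrite ltr_pdivlMr// mulrC => tC.
have cFs : 0 <= cbar i j - cF by rewrite subr_ge0.
have cBs : cbar i j - cB <= 0 by rewrite subr_le0.
have h1 := ler_wpM2l cFs Dp.
have h2 := ler_wnM2l cBs Dm.
have := SV i j cF cB adm; rewrite /gain -/A.
move: Rle tC h1 h2 wVA; rewrite /C; lra.
Qed.

Definition slack (R : realType) (m : model R) (V : grid m) i j (e : R) : Prop :=
  forall cF cB, admissible i j cF cB -> gain V i j cF cB <= residual V i j - e.

(* On a plateau [V (i - 1) = V i] the gain is nonpositive at the left end, while
   letting [cB] tend to infinity shows that its supremum is nonnegative at the
   right end; hence slack propagates to the left. *)
Lemma slack_prev (R : realType) (m : model R) (V : grid m) i j e :
  negative_grid V -> supersolution V -> 0 < e -> i != ord0 -> Dminus V i j = 0 ->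
  slack V i j e -> slack V (inord i.-1) j e.
Proof.
move=> V0 SV e0 i0 D0 gi cF cB adm.
have q0 := wt_gt0 m (V0 i j).
have re : e <= residual V i j.
  apply/ler_addgt0Pl => d d0; have [c [ac kc]] := kap_small m (cbar i j) (divr_gt0 d0 q0).
  have admc : admissible i j (cbar i j) c.
    by split=> //; [exact: cbar_gt0|move/eqP; rewrite (negbTE i0)].
  have := gi _ _ admc; rewrite /gain D0 subrr mul0r mulr0 addr0 sub0r addrAC subrr add0r.
  by move: kc; rewrite ler_pdivlMr// mulrC => kc; lra.
have i1 : (0 < i)%N by rewrite lt0n.
set k : 'I_(nI m).+1 := inord i.-1 in adm *.
have kE : k = i.-1 :> nat by rewrite inordK// (leq_ltn_trans (leq_pred _)).
have ki : inord k.+1 = i by rewrite kE prednK// inord_val.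
have dx0 := dx_gt0 m.
have Vki : V k j = V i j.
  apply/eqP; rewrite -subr_eq0 -oppr_eq0 opprB; move/eqP: D0.
  by rewrite /Dminus mulf_eq0 invr_eq0 (gt_eqF dx0) orbF.
have jle : V k (rev_ord j) <= V i (rev_ord j).
  have := supersolution_Dminus_ge0 (rev_ord j) V0 SV i0.
  by rewrite /Dminus pmulr_lge0 ?invr_gt0// subr_ge0.
have rle : residual V i j <= residual V k j.
  rewrite /residual /jump Vki lerD2l lerN2 ler_pM2l ?lam_gt0//; lra.
have Dp0 : Dplus V k j = 0 by rewrite /Dplus ki Vki subrr mul0r.
have [cF0 cFle cBge cB0 _] := adm.
have Dm0 : (cbar k j - cB) * Dminus V k j <= 0.
  have [/cB0 ->|k0] := eqVneq k ord0; first by rewrite subrr mul0r.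
  by rewrite mulr_le0_ge0 ?subr_le0// supersolution_Dminus_ge0.
have A0 : 0 <= wt m (V k j) * (kap m cF + kap m cB - kap m (cbar k j)).
  by rewrite mulr_ge0 ?ltW ?(kap_sum_ge0 adm)// wt_gt0.
rewrite /gain Dp0 mulr0; lra.
Qed.

(** Lowering a node of zero backward slope would make that slope negative. Moving left along the
    plateau keeps the slack and stops at a positive slope or at the left end. *)
Lemma slack_leftmost (R : realType) (m : model R) (V : grid m) i j e :
  negative_grid V -> supersolution V -> 0 < e -> slack V i j e ->
  exists k, slack V k j e /\ (k != ord0 -> 0 < Dminus V k j).
Proof.
move=> V0 SV e0; move: {2}(nat_of_ord i) (erefl (nat_of_ord i)) => n.
elim: n i => [|n IH] i iE gi.
  by exists i; split=> //; rewrite -val_eqE/= iE.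
have i0 : i != ord0 by rewrite -val_eqE/= iE.
have := supersolution_Dminus_ge0 j V0 SV i0.
rewrite le_eqVlt => /predU1P[/esym D0|D0]; last by exists i.
apply: (IH (inord i.-1)); last exact: slack_prev.
by rewrite inordK iE//= ltnW// -iE.
Qed.

(* Lowering a single node value keeps a supersolution a supersolution elsewhere;
   at the node itself the loss in the unbounded backward drift is absorbed by
   comparing with [(1 - k)] times the old gain. *)
Lemma supersolution_lower (R : realType) (m : model R) (U : grid m) i j e :
  negative_grid U -> supersolution U -> 0 < e -> slack U i j e ->
  (i != ord0 -> 0 < Dminus U i j) ->
  exists V : grid m, [/\ negative_grid V, supersolution V & V i j < U i j].
Proof.
move=> U0 SU e0 gU Dpos; have dx0 := dx_gt0 m; have a0 := cbar_gt0 i j.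
have rt0 : 0 < rho m / theta m by rewrite divr_gt0 ?rho_gt0 ?theta_gt0.
have q0 := wt_gt0 m (U0 i j); have l0 := lam_gt0 m j.
(* [B] bounds, per unit of [k], the loss from replacing the old gain by [1 - k] times it; [C] below
   does the same for the lowering [h]. Each loss is kept under [e / 2]. *)
pose B := cbar i j * `|Dplus U i j| + `|residual U i j| + e.
have B0 : 0 < B by rewrite ltr_wpDl// addr_ge0// mulr_ge0// ltW.
pose k := Num.min 1 (e / 2 / B).
have k0 : 0 < k by rewrite lt_min ltr01 !divr_gt0.
have k1 : k <= 1 by rewrite ge_min lexx.
have kB : k * B <= e / 2 by rewrite -ler_pdivlMr// ge_min lexx orbT.
pose C := cbar i j / dx m + rho m / theta m + lam m j.
have C0 : 0 < C by rewrite !addr_gt0// divr_gt0.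
have [d d0 dP] := wt_near m (U0 i j) (mulr_gt0 k0 q0).
(* At the left end [cB = cbar], so any positive value can stand in for the backward slope. *)
pose D := if i == ord0 then 1 else Dminus U i j.
have D0 : 0 < D by rewrite /D; case: eqP => [//|/eqP]; exact: Dpos.
(* The three bounds keep the change of [wt] below [k * wt], keep [h * C] below [e / 2], and leave a
   backward slope of at least [(1 - k)] times the old one. *)
pose h := Num.min (Num.min (d / 2) (e / 2 / C)) (k * (D * dx m)).
have h0 : 0 < h.
  rewrite !lt_min; apply/andP; split; last by apply: mulr_gt0 => //; exact: mulr_gt0.
  by rewrite !divr_gt0.
have hd : h < d.
  by apply: (@le_lt_trans _ _ (d / 2)); [rewrite !ge_min lexx|lra].
have hC : h * C <= e / 2 by rewrite -ler_pdivlMr// !ge_min lexx orbT.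
have hD : h / dx m <= k * D by rewrite ler_pdivrMr// -mulrA !ge_min lexx !orbT.
pose V : grid m := fun i' j' => if (i' == i) && (j' == j) then U i j - h else U i' j'.
have Vij : V i j = U i j - h by rewrite /V !eqxx.
have VU i' j' : V i' j' <= U i' j'.
  by rewrite /V; case: andP => // -[/eqP -> /eqP ->]; rewrite gerBl ltW.
exists V; split; last by rewrite Vij gtrBl.
- by move=> i' j'; exact: le_lt_trans (VU _ _) (U0 _ _).
move=> i' j' cF cB adm; have [cF0 cFle cBge cB0 _] := adm.
have [Dp Dm Rle] := grid_perturb i' j' VU.
have cFs : 0 <= cbar i' j' - cF by rewrite subr_ge0.
have cBs : cbar i' j' - cB <= 0 by rewrite subr_le0.
have h1 := ler_wpM2l cFs Dp; have h2 := ler_wnM2l cBs Dm.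
have gle := SU _ _ _ _ adm.
have [ij|ij] := boolP ((i' == i) && (j' == j)); last first.
  have VUE : V i' j' = U i' j' by rewrite /V (negbTE ij).
  move: h1 h2 Rle gle; rewrite /gain VUE subrr mul0r mulr0 !addr0 subr0; lra.
move: ij adm cB0 cFle Dp Dm Rle cFs cBs h1 h2 gle => /andP[/eqP -> /eqP ->] adm cB0 cFle.
rewrite Vij subKr => _ _ Rle cFs cBs h1 h2 _.
have h3 : (cbar i j - cB) * (Dminus U i j - h / dx m) <=
          (1 - k) * ((cbar i j - cB) * Dminus U i j).
  have [/cB0 ->|i0] := eqVneq i ord0; first by rewrite subrr !mul0r mulr0.
  rewrite mulrCA; apply: ler_wnM2l => //.
  by move: hD; rewrite /D (negbTE i0); lra.
have h4 : (cbar i j - cF) * (Dplus U i j + h / dx m) <=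
   (1 - k) * ((cbar i j - cF) * Dplus U i j) +
     cbar i j * (k * `|Dplus U i j|) + cbar i j * (h / dx m).
  have t1 : (cbar i j - cF) * (k * Dplus U i j) <= cbar i j * (k * `|Dplus U i j|).
    apply: (@le_trans _ _ ((cbar i j - cF) * (k * `|Dplus U i j|))).
      by rewrite ler_wpM2l// ler_pM2l// ler_norm.
    by rewrite ler_wpM2r ?mulr_ge0 ?(ltW k0)// gerBl ltW.
  have t2 : 0 <= cF * (h / dx m) by rewrite mulr_ge0 ?(ltW cF0)// ltW// divr_gt0.
  lra.
have wV : (1 - k) * wt m (U i j) <= wt m (V i j).
  have : `|U i j - V i j| < d by rewrite Vij subKr gtr0_norm.
  move=> /dP /ltW; have := ler_norm (wt m (U i j) - wt m (V i j)); lra.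
have h5 := ler_wpM2r (ltW (kap_sum_ge0 adm)) wV.
have gk : (1 - k) * gain U i j cF cB <= (1 - k) * (residual U i j - e).
  by rewrite ler_wpM2l ?subr_ge0//; exact: gU.
have rk : - (k * residual U i j) <= k * `|residual U i j|.
  by rewrite -mulrN ler_pM2l// -normrN ler_norm.
move: kB hC h1 h2 h3 h4 h5 gk Rle; rewrite /B /C /gain; lra.
Qed.

Lemma HJB_minimal_supersolution (R : realType) (m : model R) :
  1 <= theta m -> discrete_HJB (minimal_supersolution m).
Proof.
move=> th; set U := minimal_supersolution m.
have U0 : negative_grid U by exact: minimal_supersolution_lt0.
have SU : supersolution U by exact: minimal_supersolutionP.
apply: HJB_of_sup => // i j e e0; apply: contrapT => no.
have gU : slack U i j e.
  move=> cF cB adm; rewrite leNgt; apply/negP => lt; apply: no.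
  by exists cF, cB.
have [k [gk Dk]] := slack_leftmost U0 SU e0 gU.
have [V [V0 SV Vlt]] := supersolution_lower U0 SU e0 gk Dk.
have := minimal_supersolution_le k j th V0 SV.
by rewrite leNgt Vlt.
Qed.

(** * Optimality of policy improvement *)

Lemma coptE (R : realType) (m : model R) (p v : R) : 0 < p -> v < 0 ->
  copt m p (wt m v) = rho m `^ psi m * p `^ (- psi m) * ((1 - gamma m) * v) `^ vexp m.
Proof.
move=> p0 v0; have q0 := wt_gt0 m v0.
rewrite /copt powRM ?invr_ge0 ?(ltW p0) ?(ltW q0)// wt_powR_psi// mulrAC.
by rewrite -powR_inv1 ?(ltW p0)// -powRrM mulN1r.
Qed.

Lemma consumption_pos (R : realType) (m : model R) (p v : R) : 0 < p -> v < 0 ->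
  consumption m p v = (copt m p (wt m v))%:E.
Proof. by move=> p0 v0; rewrite /consumption /pos_powN max_l ?(ltW p0)// gt_eqF// coptE. Qed.

Lemma consumption_nonpos (R : realType) (m : model R) (p v : R) : p <= 0 -> v < 0 ->
  consumption m p v = +oo%E.
Proof.
move=> p0 v0; rewrite /consumption /pos_powN max_r// eqxx.
by rewrite gt0_muley ?lte_fin ?powR_gt0 ?rho_gt0// gt0_mulye// lte_fin powR_gt0// wealth_gt0.
Qed.

(** Clipping the maximizer of a concave flow to an interval gives the maximizer on that interval; at
    nonpositive slopes the flow increases in consumption and the upper bound is optimal. *)
Lemma forward_improvement (R : realType) (m : model R) (a p v x : R) : 0 < a -> v < 0 ->
  x%:E = Order.min (consumption m p v) a%:E ->
  [/\ 0 < x, x <= a &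
      forall c, 0 < c -> c <= a -> flow m a p (wt m v) c <= flow m a p (wt m v) x].
Proof.
move=> a0 v0; have q0 := wt_gt0 m v0.
have [p0|p0] := leP p 0.
  rewrite consumption_nonpos// min_r ?leey// => -[->]; split=> // c c0 ca.
  apply: flow_le; rewrite ?(ltW q0)// mulr_le0 ?subr_le0//.
  by rewrite (le_trans p0)// mulr_ge0 ?powR_ge0// ltW.
rewrite consumption_pos// -EFin_min => -[->].
have [h|h] := leP (copt m p (wt m v)) a.
  by split=> [||c c0 _]; [exact: copt_gt0| |exact: flow_copt].
split=> // c c0 ca; apply: flow_le; rewrite ?(ltW q0)// mulr_le0 ?subr_le0//.
by rewrite -copt_ge// ltW.
Qed.

Lemma backward_improvement (R : realType) (m : model R) (M a p v x : R) :
  0 < a -> a <= M -> v < 0 ->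
  x%:E = Order.max (Order.min M%:E (consumption m p v)) a%:E ->
  [/\ a <= x, x <= M &
      forall c, a <= c -> c <= M -> flow m a p (wt m v) c <= flow m a p (wt m v) x].
Proof.
move=> a0 aM v0; have q0 := wt_gt0 m v0; have M0 := lt_le_trans a0 aM.
have [p0|p0] := leP p 0.
  rewrite consumption_nonpos// min_l ?leey// max_l ?lee_fin// => -[->]; split=> // c ca cM.
  apply: flow_le; rewrite ?(ltW q0) ?(lt_le_trans a0)// mulr_le0 ?subr_le0//.
  by rewrite (le_trans p0)// mulr_ge0 ?powR_ge0// ltW.
rewrite consumption_pos// -EFin_min -EFin_max => -[->].
have [h|h] := leP (copt m p (wt m v)) a.
  rewrite max_r ?ge_min ?h ?orbT//; split=> // c ac _.
  apply: flow_le; rewrite ?(ltW q0) ?(lt_le_trans a0)// mulr_ge0 ?subr_ge0//.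
  by rewrite -copt_le.
rewrite max_l ?le_min ?aM ?(ltW h)//.
have [h'|h'] := leP M (copt m p (wt m v)).
  split=> // c ac cM; apply: flow_le; rewrite ?(ltW q0) ?(lt_le_trans a0)//.
  by rewrite mulr_le0 ?subr_le0// -copt_ge.
split; rewrite ?(ltW h) ?(ltW h')// => c ac _.
by apply: flow_copt => //; exact: lt_le_trans ac.
Qed.

(** The gain separates in [cF] and [cB], so the two clipped choices are jointly optimal among
    policies capped by [eps^-1]. The lower bound on [eps^-1] keeps the cap above every [cbar]. *)
Lemma improvement_optimal (R : realType) (m : model R) (eps : R) (V cF cB : grid m) i j :
  negative_grid V -> rate m * xhigh m + income m ord_max < eps^-1 ->
  policy_improvement eps V cF cB ->
  [/\ admissible i j (cF i j) (cB i j), cB i j <= eps^-1 &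
      forall c d, admissible i j c d -> d <= eps^-1 ->
        gain V i j c d <= gain V i j (cF i j) (cB i j)].
Proof.
move=> V0 epsM [F FI B B0]; have a0 := cbar_gt0 i j.
have aM : cbar i j <= eps^-1 := le_trans (cbar_le_max i j) (ltW epsM).
have [cF0 cFle cFI cFopt] : [/\ 0 < cF i j, cF i j <= cbar i j,
    i = ord_max -> cF i j = cbar i j &
    forall c, 0 < c -> c <= cbar i j -> (i = ord_max -> c = cbar i j) ->
      flow m (cbar i j) (Dplus V i j) (wt m (V i j)) c <=
      flow m (cbar i j) (Dplus V i j) (wt m (V i j)) (cF i j)].
  have [i1|i1] := eqVneq i ord_max.
    have -> : cF i j = cbar i j by rewrite i1 FI /cbar xgrid_ord_max.
    by split=> // c _ _ ->.
  have [x0 xa xopt] := forward_improvement a0 (V0 i j) (F i j i1); split=> //.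
    by move/eqP; rewrite (negbTE i1).
  by move=> c c0 ca _; exact: xopt.
have [cBge cBle cB0 cBopt] : [/\ cbar i j <= cB i j, cB i j <= eps^-1,
    i = ord0 -> cB i j = cbar i j &
    forall c, cbar i j <= c -> c <= eps^-1 -> (i = ord0 -> c = cbar i j) ->
      flow m (cbar i j) (Dminus V i j) (wt m (V i j)) c <=
      flow m (cbar i j) (Dminus V i j) (wt m (V i j)) (cB i j)].
  have [i0|i0] := eqVneq i ord0.
    have -> : cB i j = cbar i j by rewrite i0 B0 /cbar /xgrid mul0r addr0.
    by split=> // c _ _ ->.
  have [ax xM xopt] := backward_improvement a0 aM (V0 i j) (B i j i0); split=> //.
    by move/eqP; rewrite (negbTE i0).
  by move=> c c0 ca _; exact: xopt.
split=> // c d [c0 ca ad d0 cI] dM; rewrite !gainE lerD2r lerD//.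
- exact: cFopt.
- exact: cBopt.
Qed.

(** * Bounded optimal policies of solutions *)

Lemma HJB_optimal_policy (R : realType) (m : model R) (W : grid m) :
  discrete_HJB W -> (forall i j, i != ord0 -> 0 < Dminus W i j) ->
  exists cF cB : grid m, forall i j, admissible i j (cF i j) (cB i j) /\
    gain W i j (cF i j) (cB i j) = residual W i j.
Proof.
move=> HW Dpos.
have /choice[f fP] : forall k : 'I_(nI m).+1 * 'I_2, exists c : R * R,
    admissible k.1 k.2 c.1 c.2 /\ gain W k.1 k.2 c.1 c.2 = residual W k.1 k.2.
  move=> [i j]; have [c [d cd]] := HJB_attained HW (Dpos i j).
  by exists (c, d).
exists (fun i j => (f (i, j)).1), (fun i j => (f (i, j)).2) => i j.
exact: (fP (i, j)).
Qed.

(** Positive slopes make the supremum in (D) attained, and comparison is applied under the policy of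
    [W] itself. *)
Lemma HJB_le_Vcheck (R : realType) (m : model R) (W : grid m) : 1 <= theta m ->
  discrete_HJB W -> (forall i j, i != ord0 -> 0 < Dminus W i j) ->
  forall i j, W i j <= Vcheck m i j.
Proof.
move=> th HW Dpos; have [cF [cB cP]] := HJB_optimal_policy HW Dpos.
have [Vc0 SVc] := Vcheck_supersolution m.
apply: (policy_comparison th HW.1 Vc0 (fun i j => (cP i j).1)) => i j.
  by rewrite (cP i j).2.
exact: SVc (cP i j).1.
Qed.

(** Truncating [cB] at [M] costs nothing: the slope bound and [W <= Vcheck] place the unconstrained
    optimum below [M], and beyond the optimum the flow decreases. *)
Lemma HJB_bounded_policy (R : realType) (m : model R) (W : grid m) (varsigma M : R) :
  1 <= theta m -> discrete_HJB W -> 0 < varsigma ->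
  (forall i j, i != ord0 -> varsigma <= Dminus W i j) ->
  (forall i j, @cbar R m i j <= M) ->
  rho m `^ psi m * varsigma `^ (- psi m) *
    ((1 - gamma m) * Vcheck m ord_max ord_max) `^ vexp m < M ->
  exists cF cB : grid m, forall i j, [/\ admissible i j (cF i j) (cB i j), cB i j <= M &
    residual W i j <= gain W i j (cF i j) (cB i j)].
Proof.
move=> th HW s0 Ds cM copM.
have Dpos i j : i != ord0 -> 0 < Dminus W i j by move=> /(Ds i j); exact: lt_le_trans.
have [cF [cB cP]] := HJB_optimal_policy HW Dpos.
exists cF, (fun i j => Num.min (cB i j) M) => i j.
have [[cF0 cFle cBge cB0 cFI] <-] := cP i j.
have a0 := cbar_gt0 i j; have aM := cM i j; have M0 := lt_le_trans a0 aM.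
have W0 := HW.1 i j; have q0 := wt_gt0 m W0.
split.
- split=> //; first by rewrite le_min cBge.
  by move=> /cB0 ->; rewrite min_l.
- by rewrite ge_min lexx orbT.
have [//|McB] := leP (cB i j) M.
have i0 : i != ord0.
  by apply/eqP => /cB0 E; move: McB; rewrite E ltNge aM.
rewrite !gainE lerD2r lerD2l; apply: flow_le => //; [exact: lt_trans McB|exact: ltW|].
rewrite mulr_ge0 ?subr_ge0 ?(ltW McB)// -copt_le ?Dpos//.
have Vc0 := (Vcheck_supersolution m).1 ord_max ord_max.
have qle : wt m (W i j) <= wt m (Vcheck m ord_max ord_max).
  apply: wt_homo => //; apply: le_trans (HJB_le_Vcheck th HW Dpos i j) _.
  exact: Vcheck_le_max.
apply: (le_trans (copt_anti m s0 (Ds i j i0) q0)).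
apply: le_trans (ltW copM); rewrite -(@coptE R m varsigma _ s0 Vc0).
apply: ge0_ler_powR; first exact: ltW (psi_gt0 m).
- by rewrite nnegrE ltW// divr_gt0.
- by rewrite nnegrE ltW// divr_gt0// wt_gt0.
- by rewrite ler_pM2r// invr_gt0.
Qed.

(** * Convergence of the iterates *)

Lemma policy_evaluation_gain (R : realType) (m : model R) (cF cB V : grid m) i j :
  policy_evaluation cF cB V -> gain V i j (cF i j) (cB i j) = residual V i j.
Proof. by move=> [_ /(_ i j)]; rewrite !Fagg_wt /residual /gain => ->; ring. Qed.

(* One step of the algorithm: the new policy nearly attains the supremum of the
   gains of the old value.  The coefficient [kap c + kap d - kap cbar], which
   blows up as [c] tends to [0], is controlled by the evaluation equation. *)
Lemma gain_increment (R : realType) (m : model R) (M : R) (V V' : grid m) i j c d (v0 : R)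
    (K := (cbar i j + M) / dx m + rho m / theta m + lam m j) :
  1 <= theta m ->
  negative_grid V' -> (forall i j, V i j <= V' i j) -> v0 < 0 -> v0 <= V i j ->
  admissible i j c d -> d <= M -> gain V' i j c d = residual V' i j ->
  gain V i j c d <= residual V i j + K * (V' i j - V i j)
    + K * - v0 / wt m v0 * (wt m (V' i j) - wt m (V i j)).
Proof.
move=> th V'0 VV' v00 v0V adm dM gV'; have [c0 ca ad d0 cI] := adm.
have a0 := cbar_gt0 i j; have l0 := lam_gt0 m j.
have dx0 := dx_gt0 m; have dxV0 : 0 < (dx m)^-1 by rewrite invr_gt0.
have rt0 : 0 < rho m / theta m by rewrite divr_gt0 ?rho_gt0 ?theta_gt0.
set A := kap m c + kap m d - kap m (cbar i j).
have A0 : 0 < A := kap_sum_ge0 adm.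
have V'ij := VV' i j.
have q0 := wt_gt0 m v00.
have q0le : wt m v0 <= wt m (V' i j) by apply: wt_homo => //; exact: le_trans V'ij.
have dwt : 0 <= wt m (V' i j) - wt m (V i j) by rewrite subr_ge0 wt_homo.
have M0 : 0 < M by lra.
have K0 : 0 <= K by rewrite ltW// !addr_gt0// divr_gt0// addr_gt0.
have t0 : 0 <= V' i j - V i j by rewrite subr_ge0.
have cFs : 0 <= cbar i j - c by rewrite subr_ge0.
have cBs : cbar i j - d <= 0 by rewrite subr_le0.
(* Since [V'] is negative, its forward differences are at most [- V' / dx] and its backward ones at
   least [V' / dx]. The evaluation equation then gives [wt (V') * A <= K * (- V')], a bound made
   uniform by [v0 <= V']. *)
have KA : A <= K * - v0 / wt m v0.
  rewrite ler_pdivlMr//; apply: (@le_trans _ _ (wt m (V' i j) * A)).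
    by rewrite mulrC ler_pM2r.
  have n0 : 0 <= - V' i j by rewrite oppr_ge0 ltW.
  apply: (@le_trans _ _ (K * - V' i j)); last first.
    by apply: ler_wpM2l => //; rewrite lerN2; exact: le_trans V'ij.
  have h1 : (cbar i j - c) * Dplus V' i j <= cbar i j * (- V' i j / dx m).
    apply: (@le_trans _ _ ((cbar i j - c) * (- V' i j / dx m))).
      by rewrite ler_wpM2l// ler_pM2r//; have := V'0 (inord i.+1) j; lra.
    apply: ler_wpM2r; first by rewrite divr_ge0 ?(ltW dx0).
    by rewrite gerBl ltW.
  have h2 : (cbar i j - d) * Dminus V' i j <= M * (- V' i j / dx m).
    apply: (@le_trans _ _ ((cbar i j - d) * (V' i j / dx m))).
      by rewrite ler_wnM2l// ler_pM2r//; have := V'0 (inord i.-1) j; lra.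
    have -> : (cbar i j - d) * (V' i j / dx m) = (d - cbar i j) * (- V' i j / dx m) by ring.
    apply: ler_wpM2r; first by rewrite divr_ge0 ?(ltW dx0).
    by rewrite lerBlDr (le_trans dM)// lerDl ltW.
  have h3 := mulr_gt0 l0 (_ : 0 < - V' i (rev_ord j)).
  have {h3} : 0 < lam m j * - V' i (rev_ord j) by apply: h3; rewrite oppr_gt0.
  move: gV'; rewrite /gain /residual /jump -/A /K; lra.
have [Dp Dm Rle] := grid_perturb i j VV'.
have h1 := ler_wpM2l cFs Dp; have h2 := ler_wnM2l cBs Dm.
have h3 := ler_wpM2r dwt KA.
have h4 : (d - c) * ((V' i j - V i j) / dx m) <= (cbar i j + M) * ((V' i j - V i j) / dx m).
  apply: ler_wpM2r; first by rewrite divr_ge0 ?(ltW dx0).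
  by rewrite lerBlDr (le_trans dM)// -addrA addrCA lerDl ltW// addr_gt0.
move: gV' h1 h2 h3 h4 Rle; rewrite /gain -/A.
move: (K * - v0 / _) => K'; rewrite /K; lra.
Qed.

Lemma Dplus_cvg (R : realType) (m : model R) (V : nat -> grid m) (L : grid m) i j :
  (forall i j, V n i j @[n --> \oo] --> L i j) ->
  Dplus (V n) i j @[n --> \oo] --> Dplus L i j.
Proof. by move=> VL; apply: cvgM; [exact: cvgB|exact: cvg_cst]. Qed.

Lemma Dminus_cvg (R : realType) (m : model R) (V : nat -> grid m) (L : grid m) i j :
  (forall i j, V n i j @[n --> \oo] --> L i j) ->
  Dminus (V n) i j @[n --> \oo] --> Dminus L i j.
Proof. by move=> VL; apply: cvgM; [exact: cvgB|exact: cvg_cst]. Qed.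

Lemma wt_cvg (R : realType) (m : model R) (v : nat -> R) (l : R) : l < 0 ->
  v n @[n --> \oo] --> l -> wt m (v n) @[n --> \oo] --> wt m l.
Proof. by move=> l0 vl; apply: continuous_cvg vl; exact: wt_continuous. Qed.

Lemma residual_cvg (R : realType) (m : model R) (V : nat -> grid m) (L : grid m) i j :
  (forall i j, V n i j @[n --> \oo] --> L i j) ->
  residual (V n) i j @[n --> \oo] --> residual L i j.
Proof.
move=> VL; apply: cvgB; first by apply: cvgM; [exact: cvg_cst|].
by apply: cvgM; [exact: cvg_cst|exact: cvgB].
Qed.

Lemma gain_cvg (R : realType) (m : model R) (V : nat -> grid m) (L : grid m) i j c d :
  negative_grid L -> (forall i j, V n i j @[n --> \oo] --> L i j) ->
  gain (V n) i j c d @[n --> \oo] --> gain L i j c d.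
Proof.
move=> L0 VL; apply: cvgB; last by apply: cvgM; [exact: wt_cvg|exact: cvg_cst].
by apply: cvgD; apply: cvgM; [exact: cvg_cst|exact: Dplus_cvg|exact: cvg_cst|exact: Dminus_cvg].
Qed.

(** The iterates increase and stay below [W], hence converge. As [W] has an optimal policy under the
    cap, every improvement step competes against that policy, which forces the limit above [W]. *)
Lemma howard_cvg (R : realType) (m : model R) (eps : R) (V cF cB : nat -> grid m)
    (W : grid m) :
  1 <= theta m -> rate m * xhigh m + income m ord_max < eps^-1 ->
  howard_newton eps V cF cB -> discrete_HJB W ->
  (exists cF' cB' : grid m, forall i j, [/\ admissible i j (cF' i j) (cB' i j),
      cB' i j <= eps^-1 & residual W i j <= gain W i j (cF' i j) (cB' i j)]) ->
  forall i j, V n i j @[n --> \oo] --> W i j.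
Proof.
move=> th epsM [F0 B0 ev im] HW [cF' [cB' cP]].
have [W0 SW] : negative_grid W /\ supersolution W by split; [exact: HW.1|exact: HJB_supersolution].
have V0 n : negative_grid (V n) := (ev n).1.
have opt n i j := @improvement_optimal R m eps _ _ _ i j (V0 n) epsM (im n).
have pol n i j : admissible i j (cF n i j) (cB n i j) /\ cB n i j <= eps^-1.
  case: n => [|n]; last by have [] := opt n i j.
  rewrite F0 B0; split; last exact: le_trans (cbar_le_max i j) (ltW epsM).
  by split=> //; exact: cbar_gt0.
have gV n i j : gain (V n) i j (cF n i j) (cB n i j) = residual (V n) i j.
  exact: policy_evaluation_gain (ev n).
(* The new policy has at least the gain of the old one at [V n], so [V n] is a subsolution of the
   next evaluation equation. *)
have Vinc n i j : V n i j <= V n.+1 i j.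
  apply: (policy_comparison th (V0 n) (V0 n.+1) (fun i j => (pol n.+1 i j).1)) => k l.
    by rewrite -gV; have [_ _] := opt n k l; apply; have [] := pol n k l.
  by rewrite gV.
have VW n i j : V n i j <= W i j.
  apply: (policy_comparison th (V0 n) W0 (fun i j => (pol n i j).1)) => k l.
    by rewrite gV.
  exact: SW (pol n k l).1.
have Vnd i j : nondecreasing_seq (fun n => V n i j).
  by apply/nondecreasing_seqP => n; exact: Vinc.
pose L : grid m := fun i j => limn (fun n => V n i j).
have VL i j : V n i j @[n --> \oo] --> L i j.
  apply: nondecreasing_is_cvgn => //; exists (W i j) => _ [n _ <-]; exact: VW.
have LW i j : L i j <= W i j.
  apply: limr_le; first by apply/cvg_ex; exists (L i j); exact: VL.
  by apply: nearW => n; exact: VW.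
have L0 : negative_grid L by move=> i j; exact: le_lt_trans (LW i j) (W0 i j).
(* Comparison under the policy of [W] requires [gain L <= residual L]; this is the limit of
   [gain_increment], whose error terms vanish because consecutive iterates share the limit [L]. *)
have WL i j : W i j <= L i j.
  apply: (policy_comparison th W0 L0 (fun i j => let: And3 a _ _ := cP i j in a)) => k l.
    by have [] := cP k l.
  have [adm le_eps _] := cP k l.
  pose K := (cbar k l + eps^-1) / dx m + rho m / theta m + lam m l.
  (* Monotonicity bounds all iterates below by [V 0], which makes this coefficient independent of
     [n]. *)
  pose K' := K * - V 0%N k l / wt m (V 0%N k l).
  have shift u (a : R) : u n @[n --> \oo] --> a -> u n.+1 @[n --> \oo] --> a.
    by move=> ua; rewrite cvg_shiftS.
  have bound : residual (V n) k l + K * (V n.+1 k l - V n k l)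
      + K' * (wt m (V n.+1 k l) - wt m (V n k l)) @[n --> \oo] --> residual L k l.
    have -> : residual L k l = residual L k l + K * (L k l - L k l)
        + K' * (wt m (L k l) - wt m (L k l)).
      by rewrite !subrr !mulr0 !addr0.
    apply: cvgD; first apply: cvgD; first exact: residual_cvg.
      by apply: cvgM; [exact: cvg_cst|apply: cvgB => //; exact: (shift (fun n => V n k l))].
    apply: cvgM; first exact: cvg_cst.
    by apply: cvgB; [apply: (shift (fun n => wt m (V n k l)))|]; exact: wt_cvg.
  have gL := @gain_cvg R m V L k l (cF' k l) (cB' k l) L0 VL.
  apply: (ler_cvg_to gL bound); apply: nearW => n.
  have [_ _ /(_ _ _ adm le_eps) gle] := opt n k l; apply: (le_trans gle).
  have [adm1 le_eps1] := pol n.+1 k l.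
  have V0n := Vnd k l _ _ (leq0n n).
  exact: (gain_increment th (V0 n.+1) (Vinc n) (V0 0%N k l) V0n adm1 le_eps1 (gV n.+1 k l)).
by move=> i j; rewrite (_ : W i j = L i j)//; apply/eqP; rewrite eq_le WL LW.
Qed.

Theorem theorem4p8 (R : realType) (m : model R) (varsigma eps : R)
    (V cF cB : nat -> grid m) :
  1 <= theta m ->
  0 < varsigma ->
  (forall U : grid m, discrete_HJB U ->
     forall (i : 'I_(nI m).+1) (j : 'I_2),
       i != ord0 -> varsigma <= Dminus U i j) ->
  0 < eps ->
  rate m * xhigh m + income m ord_max < eps^-1 ->
  rho m `^ psi m * varsigma `^ (- psi m) *
    ((1 - gamma m) * Vcheck m ord_max ord_max) `^ vexp m < eps^-1 ->
  howard_newton eps V cF cB ->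
  exists U : grid m,
    [/\ discrete_HJB U,
        forall W : grid m, discrete_HJB W -> W = U &
        forall i j, (fun n => V n i j) @ \oo --> U i j].
Proof.
move=> th s0 Ds _ epsM copM HN.
have VW W : discrete_HJB W -> forall i j, (fun n => V n i j) @ \oo --> W i j.
  move=> HW; apply: (howard_cvg th epsM HN HW).
  apply: (HJB_bounded_policy th HW s0 (Ds W HW) _ copM) => i j.
  exact: le_trans (cbar_le_max i j) (ltW epsM).
have HU := HJB_minimal_supersolution th.
exists (minimal_supersolution m); split=> //; last exact: VW.
move=> W HW; apply/funext => i; apply/funext => j.
exact: cvg_unique (VW W HW i j) (VW _ HU i j).
Qed.
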